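(* Let $R$ be an integral domain. Then $R$ is a P$v$MD if and only if every pure $w$-injective divisible $R$-module is injective.
   Context: $R$ is an integral domain with $1\ne 0$ and quotient field $K$; modules are unitary. An $R$-module $D$ is divisible if $rD=D$ for every nonzero $r\in R$. A finitely generated ideal $J$ of $R$ is a GV-ideal, $J\in \mathrm{GV}(R)$, if the natural map $R\to\operatorname{Hom}_R(J,R)$, $r\mapsto (x\mapsto rx)$, is an isomorphism. An $R$-module $M$ is GV-torsion-free if $Jx=0$ with $J\in\mathrm{GV}(R)$, $x\in M$ forces $x=0$. For $M$ GV-torsion-free with injective envelope $E(M)$, $M_w=\{x\in E(M): Jx\subseteq M\text{ for some }J\in \mathrm{GV}(R)\}$, and $M$ is a $w$-module if $M_w=M$. A $w$-ideal is an ideal of $R$ that is a $w$-module; $w\text{-}\mathrm{Max}(R)$ is the set of ideals maximal among proper $w$-ideals (these are prime). $R$ is a P$v$MD (Prüfer $v$-multiplication domain) if every nonzero finitely generated ideal $I$ of $R$ is $w$-invertible, i.e. $(II^{-1})_w=R$, where $I^{-1}=\{x\in K: Ix\subseteq R\}$. A homomorphism $f\colon N\to M$ of $R$-modules is a $w$-monomorphism if $f_{\mathfrak m}$ is injective for every $\mathfrak m\in w\text{-}\mathrm{Max}(R)$ (so $f$ itself need not be injective). A $w$-monomorphism $f\colon N\to M$ is $w$-pure if $f\otimes_R L\colon N\otimes_R L\to M\otimes_R L$ is a $w$-monomorphism for every $R$-module $L$. An $R$-module $E$ is pure $w$-injective if it is injective with respect to all $w$-pure $w$-monomorphisms, i.e.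 for every $w$-pure $w$-monomorphism $f\colon N\to M$ the map $\operatorname{Hom}_R(M,E)\to\operatorname{Hom}_R(N,E)$ is surjective. *)

(* Defs.v *)
From HB Require Import structures.
From mathcomp Require Import all_boot all_algebra.
From mathcomp Require Import boolp classical_sets.
From mathcomp.multinomials Require Import freeg.
From mathcomp Require Import ring.

Set Implicit Arguments.
Unset Strict Implicit.
Unset Printing Implicit Defensive.
Import GRing.Theory.
Local Open Scope ring_scope.
Local Open Scope classical_set_scope.
Local Open Scope quotient_scope.

(* An R-module is an [lmodType R]; a submodule of V is a boolean predicate with
   a [submodClosed V] structure (classically, no restriction); an ideal of R is
   a submodule of the regular module R^o. *)

Section Submodules.
Variables (R : idomainType) (V : lmodType R).

Definition submod (S : submodClosed V) : Type := {x : V | x \in S}.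

HB.instance Definition _ (S : submodClosed V) := SubChoice.on (submod S).
HB.instance Definition _ (S : submodClosed V) :=
  [SubChoice_isSubLmodule of submod S by <:].

Definition submod_incl (S : submodClosed V) : {linear submod S -> V} :=
  (val : submod S -> V).

Definition generated (A : set V) : {pred V} :=
  fun x => `[< forall S : submodClosed V, (forall y, A y -> y \in S) -> x \in S >].

Lemma generated_submod_closed A : subsemimod_closed (generated A).
Proof.
split; [split|].
- by apply/asboolP => S _; exact: rpred0.
- move=> x y /asboolP xA /asboolP yA; apply/asboolP => S AS.
  by apply: rpredD; [exact: xA | exact: yA].
- by move=> a x /asboolP xA; apply/asboolP => S AS; apply: rpredZ; exact: xA.
Qed.

HB.instance Definition _ A :=
  GRing.isSubmodClosed.Build R V (generated A) (generated_submod_closed A).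

Lemma mem_generated (A : set V) x : A x -> x \in generated A.
Proof. by move=> Ax; apply/asboolP => S; exact. Qed.

Lemma generated_min (A : set V) (S : submodClosed V) :
  (forall y, A y -> y \in S) -> {subset generated A <= S}.
Proof. by move=> AS x /asboolP; apply. Qed.

Section Kernel.
Variables (W : lmodType R) (f : {linear V -> W}).

Definition lin_ker : {pred V} := fun x => f x == 0.

Fact lin_ker_submod_closed : subsemimod_closed lin_ker.
Proof.
split; [split|].
- by rewrite unfold_in linear0.
- by move=> x y /eqP fx /eqP fy; rewrite unfold_in linearD fx fy addr0.
- by move=> a x /eqP fx; rewrite unfold_in linearZ /= fx scaler0.
Qed.

HB.instance Definition _ :=
  GRing.isSubmodClosed.Build R V lin_ker lin_ker_submod_closed.

Lemma generated_ker (A : set V) :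
  (forall y, A y -> f y = 0) -> {in generated A, forall x, f x = 0}.
Proof.
move=> fA x xA; apply/eqP; rewrite -[_ == _]/(x \in lin_ker).
by apply: generated_min xA => y /fA fy; rewrite unfold_in fy.
Qed.

End Kernel.

Definition finitely_generated (S : submodClosed V) : Prop :=
  exists s : seq V, S =i generated [set x | x \in s].

End Submodules.

Section QuotientModule.
Variables (R : idomainType) (V : lmodType R) (S : submodClosed V).

(* Over a ring, submodClosed is not linked in the hierarchy to the zmodClosed
   structure that the library's additive quotient requires. *)
Definition quot_pred : {pred V} := fun x => x \in S.

Fact quot_pred_zmod_closed : zmod_closed quot_pred.
Proof.
have [S0 SB] : zmod_closed S by exact/GRing.subsemimod_closedB/GRing.subsemimodClosedP.
by split.
Qed.

HB.instance Definition _ :=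
  GRing.isZmodClosed.Build V quot_pred quot_pred_zmod_closed.

Definition quotmod : Type := Quotient.quot quot_pred.
HB.instance Definition _ := Choice.on quotmod.
HB.instance Definition _ := GRing.Zmodule.on quotmod.
HB.instance Definition _ := ZmodQuotient.on quotmod.

Definition quot_proj (x : V) : quotmod := \pi_quotmod x.

Lemma quot_proj_surj (z : quotmod) : exists x, z = quot_proj x.
Proof. by exists (repr z); rewrite /quot_proj reprK. Qed.

Lemma quot_projP (x y : V) : reflect (quot_proj x = quot_proj y) (x - y \in S).
Proof.
apply: (iffP idP) => [xy|/eqP]; last by rewrite -(Quotient.idealrBE quot_pred).
by apply/eqP; rewrite -(Quotient.idealrBE quot_pred).
Qed.

Lemma quot_projD (x y : V) : quot_proj (x + y) = quot_proj x + quot_proj y.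
Proof. exact: (Quotient.pi_add quot_pred). Qed.

Definition quot_scale (a : R) (z : quotmod) : quotmod := quot_proj (a *: repr z).

Lemma quot_projZ a (x : V) : quot_scale a (quot_proj x) = quot_proj (a *: x).
Proof.
apply/quot_projP; rewrite -scalerBr; apply: rpredZ.
by apply/quot_projP; rewrite /quot_proj reprK.
Qed.

Fact quot_scaleA a b z : quot_scale a (quot_scale b z) = quot_scale (a * b) z.
Proof. by have [x ->] := quot_proj_surj z; rewrite !quot_projZ scalerA. Qed.

Fact quot_scale1 : left_id 1 quot_scale.
Proof. by move=> z; have [x ->] := quot_proj_surj z; rewrite quot_projZ scale1r. Qed.

Fact quot_scaleDr : right_distributive quot_scale +%R.
Proof.
move=> a z t; have [x ->] := quot_proj_surj z; have [y ->] := quot_proj_surj t.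
by rewrite -quot_projD !quot_projZ -quot_projD scalerDr.
Qed.

Fact quot_scaleDl z : {morph quot_scale^~ z : a b / a + b}.
Proof.
move=> a b; have [x ->] := quot_proj_surj z.
by rewrite !quot_projZ -quot_projD scalerDl.
Qed.

HB.instance Definition _ := GRing.Zmodule_isLmodule.Build R quotmod
  quot_scaleA quot_scale1 quot_scaleDr quot_scaleDl.

Fact quot_proj_linear : linear quot_proj.
Proof. by move=> a x y; rewrite quot_projD -quot_projZ. Qed.

HB.instance Definition _ := GRing.isLinear.Build R V quotmod _ quot_proj
  quot_proj_linear.

Definition quot_lift (W : lmodType R) (f : {linear V -> W})
  (fS : {in S, forall x, f x = 0}) (z : quotmod) : W := f (repr z).

Variables (W : lmodType R) (f : {linear V -> W}).
Hypothesis fS : {in S, forall x, f x = 0}.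

Lemma quot_lift_proj x : quot_lift fS (quot_proj x) = f x.
Proof.
apply/eqP; rewrite -subr_eq0 -linearB; apply/eqP/fS/quot_projP.
by rewrite /quot_proj reprK.
Qed.

Fact quot_lift_linear : linear (quot_lift fS).
Proof.
move=> a z t; have [x ->] := quot_proj_surj z; have [y ->] := quot_proj_surj t.
by rewrite -linearP !quot_lift_proj linearP.
Qed.

HB.instance Definition _ := GRing.isLinear.Build R quotmod W _ (quot_lift fS)
  quot_lift_linear.

End QuotientModule.

Section Tensor.
Variables (R : idomainType) (M N : lmodType R).

Definition free_pairs := {freeg (M * N)%type / R}.
HB.instance Definition _ := GRing.Lmodule.on free_pairs.

Definition pair_gen (x : M) (y : N) : free_pairs := Freeg [:: (1, (x, y))].

Definition tensor_relations : set free_pairs :=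
  [set z | (exists x x' y, z = pair_gen (x + x') y - pair_gen x y - pair_gen x' y)
        \/ (exists x y y', z = pair_gen x (y + y') - pair_gen x y - pair_gen x y')
        \/ (exists a x y, z = pair_gen (a *: x) y - a *: pair_gen x y)
        \/ (exists a x y, z = pair_gen x (a *: y) - a *: pair_gen x y)].

Definition tensor : Type := quotmod (generated tensor_relations).
HB.instance Definition _ := GRing.Lmodule.on tensor.

Definition tens (x : M) (y : N) : tensor := quot_proj _ (pair_gen x y).

Lemma tensDl x x' y : tens (x + x') y = tens x y + tens x' y.
Proof.
rewrite /tens -linearD; apply/quot_projP/mem_generated.
by left; exists x, x', y; rewrite opprD addrA.
Qed.

Lemma tensDr x y y' : tens x (y + y') = tens x y + tens x y'.
Proof.
rewrite /tens -linearD; apply/quot_projP/mem_generated.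
by right; left; exists x, y, y'; rewrite opprD addrA.
Qed.

Lemma tensZl a x y : tens (a *: x) y = a *: tens x y.
Proof.
rewrite /tens -linearZ; apply/quot_projP/mem_generated.
by do 2 right; left; exists a, x, y.
Qed.

Lemma tensZr a x y : tens x (a *: y) = a *: tens x y.
Proof.
rewrite /tens -linearZ; apply/quot_projP/mem_generated.
by do 3 right; exists a, x, y.
Qed.

Section Lift.
Variables (P : lmodType R) (b : M -> N -> P).
Hypothesis bDl : forall x x' y, b (x + x') y = b x y + b x' y.
Hypothesis bDr : forall x y y', b x (y + y') = b x y + b x y'.
Hypothesis bZl : forall a x y, b (a *: x) y = a *: b x y.
Hypothesis bZr : forall a x y, b x (a *: y) = a *: b x y.

Definition free_lift : free_pairs -> P := fglift (fun p : M * N => b p.1 p.2).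

Lemma free_lift_gen x y : free_lift (pair_gen x y) = b x y.
Proof. by rewrite /free_lift liftU scale1r. Qed.

Fact free_liftB : {morph free_lift : u v / u - v}.
Proof. exact: lift_is_additive. Qed.

Fact free_lift0 : free_lift 0 = 0.
Proof. by rewrite -(subrr (0 : free_pairs)) free_liftB subrr. Qed.

Fact free_liftD : {morph free_lift : u v / u + v}.
Proof.
move=> u v; rewrite -{1}[v]opprK -[- v]add0r !free_liftB free_lift0 sub0r.
by rewrite opprK.
Qed.

Fact free_lift_linear : linear free_lift.
Proof.
move=> a u v; rewrite free_liftD; congr (_ + _).
rewrite -[in RHS](freeg_sumE u) [in RHS](big_morph _ free_liftD free_lift0) scaler_sumr.
rewrite -[LHS]/(free_lift (fgscale a u)) /fgscale.
rewrite (big_morph _ free_liftD free_lift0).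
by apply: eq_bigr => p _; rewrite /free_lift !liftU scalerA.
Qed.

HB.instance Definition _ := GRing.isLinear.Build R free_pairs P _ free_lift
  free_lift_linear.

Fact free_lift_relations :
  {in generated tensor_relations, forall z, free_lift z = 0}.
Proof.
apply: generated_ker => z.
case=> [[x [x' [y ->]]]|[[x [y [y' ->]]]|[[a [x [y ->]]]|[a [x [y ->]]]]]].
- by rewrite !linearB /= !free_lift_gen bDl addrAC addrK subrr.
- by rewrite !linearB /= !free_lift_gen bDr addrAC addrK subrr.
- by rewrite linearB linearZ /= !free_lift_gen bZl subrr.
- by rewrite linearB linearZ /= !free_lift_gen bZr subrr.
Qed.

Definition tensor_lift : {linear tensor -> P} := quot_lift free_lift_relations.

Lemma tensor_liftE x y : tensor_lift (tens x y) = b x y.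
Proof.
exact: etrans (quot_lift_proj free_lift_relations _) (free_lift_gen x y).
Qed.

End Lift.
End Tensor.

Section TensorMap.
Variables (R : idomainType) (N M : lmodType R) (f : {linear N -> M}).
Variable (L : lmodType R).

Fact tensor_mapDl x x' (y : L) :
  tens (f (x + x')) y = tens (f x) y + tens (f x') y.
Proof. by rewrite linearD tensDl. Qed.

Fact tensor_mapDr x (y y' : L) :
  tens (f x) (y + y') = tens (f x) y + tens (f x) y'.
Proof. exact: tensDr. Qed.

Fact tensor_mapZl a x (y : L) : tens (f (a *: x)) y = a *: tens (f x) y.
Proof. by rewrite linearZ /= tensZl. Qed.

Fact tensor_mapZr a x (y : L) : tens (f x) (a *: y) = a *: tens (f x) y.
Proof. exact: tensZr. Qed.

Definition tensor_map : {linear tensor N L -> tensor M L} :=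
  tensor_lift tensor_mapDl tensor_mapDr tensor_mapZl tensor_mapZr.

Lemma tensor_mapE x y : tensor_map (tens x y) = tens (f x) y.
Proof. exact: tensor_liftE. Qed.

End TensorMap.

Section Localization.
Variables (R : idomainType) (m : submodClosed R^o).

Definition prime_ideal : Prop := 1 \notin m /\ prime_idealr_closed m.

Hypothesis m_prime : prime_ideal.

Definition denominators : Type := {s : R^o | s \notin m}.

Section Module.
Variable M : lmodType R.

Definition loc_equiv (p q : M * denominators) : bool :=
  `[< exists2 u : R, (u : R^o) \notin m &
        u *: ((val q.2 : R) *: p.1 - (val p.2 : R) *: q.1) = 0 >].

Fact loc_equiv_refl : reflexive loc_equiv.
Proof.
by move=> p; apply/asboolP; exists 1; rewrite ?subrr ?scaler0 //; case: m_prime.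
Qed.

Fact loc_equiv_sym : symmetric loc_equiv.
Proof.
suff H p q : loc_equiv p q -> loc_equiv q p by move=> p q; apply/idP/idP; exact: H.
move=> /asboolP[u um uE]; apply/asboolP; exists u => //.
by rewrite -opprB scalerN uE oppr0.
Qed.

Fact loc_equiv_trans : transitive loc_equiv.
Proof.
move=> q p r /asboolP[u um uE] /asboolP[v vm vE]; apply/asboolP.
have notinM (a b : R) : (a : R^o) \notin m -> (b : R^o) \notin m ->
    (a * b : R^o) \notin m.
  by move=> am bm; apply/negP => /(proj2 m_prime); rewrite (negbTE am) (negbTE bm).
exists (u * v * val q.2); first by rewrite !notinM // (valP q.2).
have pq : u *: ((val q.2 : R) *: p.1) = u *: ((val p.2 : R) *: q.1).
  by apply/eqP; rewrite -subr_eq0 -scalerBr uE.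
have qr : v *: ((val r.2 : R) *: q.1) = v *: ((val q.2 : R) *: r.1).
  by apply/eqP; rewrite -subr_eq0 -scalerBr vE.
apply/eqP; rewrite scalerBr subr_eq0; apply/eqP.
have -> : (u * v * val q.2) *: ((val r.2 : R) *: p.1) =
          (v * val r.2) *: (u *: ((val q.2 : R) *: p.1)).
  by rewrite !scalerA; congr (_ *: _); ring.
rewrite pq.
have -> : (v * val r.2) *: (u *: ((val p.2 : R) *: q.1)) =
          (u * val p.2) *: (v *: ((val r.2 : R) *: q.1)).
  by rewrite !scalerA; congr (_ *: _); ring.
by rewrite qr !scalerA; congr (_ *: _); ring.
Qed.

Canonical loc_equiv_rel :=
  EquivRel loc_equiv loc_equiv_refl loc_equiv_sym loc_equiv_trans.

(* M_m as the set of fractions x / s with s outside m; injectivity of f_m only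
   involves the underlying map, so no module structure is put on M_m. *)
Definition localization : Type := {eq_quot loc_equiv}.
HB.instance Definition _ := Choice.on localization.
HB.instance Definition _ : EqQuotient _ loc_equiv localization :=
  EqQuotient.on localization.

Definition loc_frac (x : M) (s : denominators) : localization :=
  \pi_localization (x, s).

Lemma loc_fracP x s y t : loc_frac x s = loc_frac y t <->
  exists2 u : R, (u : R^o) \notin m &
    u *: ((val t : R) *: x - (val s : R) *: y) = 0.
Proof.
split=> [/eqmodP /asboolP //|H]; exact/eqmodP/asboolP.
Qed.

Lemma loc_frac_surj (z : localization) : exists x s, z = loc_frac x s.
Proof.
by exists (repr z).1, (repr z).2; rewrite /loc_frac -surjective_pairing reprK.
Qed.

End Module.

Definition loc_map (N M : lmodType R) (f : {linear N -> M}) (z : localization N) :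
  localization M := loc_frac (f (repr z).1) (repr z).2.

Lemma loc_mapE (N M : lmodType R) (f : {linear N -> M}) x s :
  loc_map f (loc_frac x s) = loc_frac (f x) s.
Proof.
have : loc_frac (repr (loc_frac x s)).1 (repr (loc_frac x s)).2 = loc_frac x s.
  by rewrite /loc_frac -surjective_pairing reprK.
rewrite /loc_map => /loc_fracP[u um uE]; apply/loc_fracP; exists u => //.
by rewrite -!linearZ -linearB -linearZ uE linear0.
Qed.

End Localization.

Arguments loc_map {R m} m_prime {N M} f z.

Section Modules.
Variable R : idomainType.

Definition injective_wrt (E N M : lmodType R) (f : {linear N -> M}) : Prop :=
  forall g : {linear N -> E}, exists h : {linear M -> E}, forall x, h (f x) = g x.

Definition injective_module (E : lmodType R) : Prop :=
  forall (N M : lmodType R) (f : {linear N -> M}),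
    injective f -> injective_wrt E f.

Definition divisible_module (D : lmodType R) : Prop :=
  forall r : R, r != 0 -> forall x : D, exists y : D, r *: y = x.

Definition essential (M E : lmodType R) (i : {linear M -> E}) : Prop :=
  forall S : submodClosed E, (exists2 y, y \in S & y != 0) ->
    exists2 x : M, i x \in S & i x != 0.

Definition injective_envelope (M E : lmodType R) (i : {linear M -> E}) : Prop :=
  [/\ injective i, injective_module E & essential i].

Definition GV_map (J : submodClosed R^o) (r : R) : {linear submod J -> R^o} :=
  r \*: (submod_incl J).

Definition GV_ideal (J : submodClosed R^o) : Prop :=
  finitely_generated J /\ bijective (@GV_map J).

Definition GV_torsion_free (M : lmodType R) : Prop :=
  forall (J : submodClosed R^o) (x : M), GV_ideal J ->
    (forall j : R, (j : R^o) \in J -> j *: x = 0) -> x = 0.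

(* A_w, computed in the ambient module E, which is meant to be an injective
   envelope of the submodule A. *)
Definition w_envelope (E : lmodType R) (A : set E) : set E :=
  [set x | exists2 J : submodClosed R^o, GV_ideal J &
     forall j : R, (j : R^o) \in J -> A (j *: x)].

Definition w_module (M : lmodType R) : Prop :=
  GV_torsion_free M /\
  forall (E : lmodType R) (i : {linear M -> E}), injective_envelope i ->
    w_envelope (range i) = range i.

Definition w_ideal (I : submodClosed R^o) : Prop := w_module (submod I).

Definition w_Max (m : submodClosed R^o) : Prop :=
  [/\ w_ideal m, 1 \notin m &
   forall I : submodClosed R^o, w_ideal I -> 1 \notin I ->
     {subset m <= I} -> {subset I <= m}].

(* Members of w-Max(R) are always prime; m_prime only makes M_m well defined. *)
Definition w_monomorphism (N M : lmodType R) (f : {linear N -> M}) : Prop :=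
  forall (m : submodClosed R^o) (m_prime : prime_ideal m), w_Max m ->
    injective (loc_map m_prime f).

Definition w_pure (N M : lmodType R) (f : {linear N -> M}) : Prop :=
  forall L : lmodType R, w_monomorphism (tensor_map f L).

Definition pure_w_injective (E : lmodType R) : Prop :=
  forall (N M : lmodType R) (f : {linear N -> M}),
    w_monomorphism f -> w_pure f -> injective_wrt E f.

End Modules.

Section QuotientField.
Variable R : idomainType.

Definition fracmod : Type := {fraction R}.
HB.instance Definition _ := GRing.Field.on fracmod.

Definition fracmod_scale (a : R) (x : fracmod) : fracmod := tofrac a * x.

Fact fracmod_scaleA a b x :
  fracmod_scale a (fracmod_scale b x) = fracmod_scale (a * b) x.
Proof. by rewrite /fracmod_scale tofracM mulrA. Qed.

Fact fracmod_scale1 : left_id 1 fracmod_scale.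
Proof. by move=> x; rewrite /fracmod_scale tofrac1 mul1r. Qed.

Fact fracmod_scaleDr : right_distributive fracmod_scale +%R.
Proof. by move=> a x y; rewrite /fracmod_scale mulrDr. Qed.

Fact fracmod_scaleDl x : {morph fracmod_scale^~ x : a b / a + b}.
Proof. by move=> a b; rewrite /fracmod_scale tofracD mulrDl. Qed.

HB.instance Definition _ := GRing.Zmodule_isLmodule.Build R fracmod
  fracmod_scaleA fracmod_scale1 fracmod_scaleDr fracmod_scaleDl.

Definition ring_in_K : set fracmod := range (fun r : R => tofrac r).

Definition ideal_inverse (I : submodClosed R^o) : set fracmod :=
  [set x | forall a : R, (a : R^o) \in I -> ring_in_K (a *: x)].

Definition ideal_mul_inverse (I : submodClosed R^o) : {pred fracmod} :=
  generated [set z : fracmod | exists (a : R) (x : fracmod),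
    [/\ (a : R^o) \in I, ideal_inverse I x & z = a *: x]].

(* K, being divisible and torsion-free, is an injective envelope of each of its
   nonzero submodules, so (I I^-1)_w is computed in K. *)
Definition w_invertible (I : submodClosed R^o) : Prop :=
  w_envelope [set x | x \in ideal_mul_inverse I] = ring_in_K.

Definition PvMD : Prop :=
  forall I : submodClosed R^o, finitely_generated I ->
    (exists2 a, a \in I & a != 0) -> w_invertible I.

End QuotientField.

(* Main.v *)
(* Fix [m] in w-Max(R). If R is a PvMD then R_m is a valuation domain, and over
   it a linear system with a matrix of coefficients can be brought to echelon
   form, so that a system solvable in an extension of a divisible module D is
   already solvable in D up to a factor outside [m]. Hence every embedding of D
   is w-pure, and a pure w-injective D splits off the pushout along any
   extension problem.

   Conversely, if E is an injective cogenerator and X is a torsion-free module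
   on which the complement of [m] acts invertibly, then Hom(X, E) is divisible
   and, by tensor-hom adjunction, pure w-injective. If [a] and [b] were
   incomparable in R_m, take X = a R_m + b R_m and mu : X -> X/mX -> E with
   mu(b) <> 0: then s a + r b |-> s mu is a well-defined map from (a, b) to
   Hom(X, E) which cannot extend to R, as an extension would satisfy
   mu(b) = phi(a b) = phi(b a) = 0. So each R_m is a valuation domain, no
   maximal w-ideal contains I I^-1, and I is w-invertible. *)

Require Import Defs.
From HB Require Import structures.
From mathcomp Require Import all_boot all_algebra.
From mathcomp Require Import boolp classical_sets functions.
From mathcomp.multinomials Require Import freeg.
From mathcomp Require Import ring.

Set Implicit Arguments.
Unset Strict Implicit.
Unset Printing Implicit Defensive.
Import GRing.Theory.
Local Open Scope ring_scope.
Local Open Scope classical_set_scope.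
Local Open Scope quotient_scope.

(** * Linear maps and submodules built from plain functions and sets *)

Section LinearMaps.
Variables (R : idomainType) (U V : lmodType R).

Definition linear_of (f : U -> V) (fl : linear f) : {linear U -> V} :=
  HB.pack f (GRing.isLinear.Build R U V _ f fl).

Lemma linear_ofE f (fl : linear f) x : linear_of fl x = f x.
Proof. by []. Qed.

Lemma linear_eq (f g : {linear U -> V}) : f =1 g -> f = g.
Proof.
case: f g => [f [[f1] [f2]]] [g [[g1] [g2]]] /= fg.
have {}fg : f = g by apply/funext.
case: _ / fg in g1 g2 *.
by rewrite (Prop_irrelevance f1 g1) (Prop_irrelevance f2 g2).
Qed.

Lemma linear_congr (f g : {linear U -> V}) : f = g -> f =1 g.
Proof. by move=> ->. Qed.

Definition submod_pred (P : set U) : {pred U} := fun x => `[< P x >].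

Lemma submod_pred_closed (P : set U) : P 0 ->
  (forall a x y, P x -> P y -> P (a *: x + y)) -> subsemimod_closed (submod_pred P).
Proof.
move=> P0 PD; split; [split|].
- exact/asboolP.
- by move=> x y /asboolP Px /asboolP Py; apply/asboolP; rewrite -[x]scale1r; exact: PD.
- by move=> a x /asboolP Px; apply/asboolP; rewrite -[a *: x]addr0; exact: PD.
Qed.

Definition submod_of (P : set U) (P0 : P 0)
    (PD : forall a x y, P x -> P y -> P (a *: x + y)) : submodClosed U :=
  HB.pack (submod_pred P)
    (GRing.isSubmodClosed.Build R U (submod_pred P) (submod_pred_closed P0 PD)).

Lemma submod_ofP (P : set U) P0 PD x : reflect (P x) (x \in @submod_of P P0 PD).
Proof. exact: asboolP. Qed.

End LinearMaps.

(* Baer's criterion, with [T] the graph of a linear map from an ideal to E. *)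
Definition baer (R : idomainType) (E : lmodType R) : Prop :=
  forall T : set (R * E),
    (forall a p q, T p -> T q -> T (a * p.1 + q.1, a *: p.2 + q.2)) ->
    (forall e, T (0, e) -> e = 0) ->
  exists e0, forall p, T p -> p.2 = p.1 *: e0.

(** * Baer's criterion for injectivity *)

Section Baer.
Variables (R : idomainType) (E : lmodType R).

(** Zorn's lemma gives a maximal graph [B] of a partial linear map extending the pairs [(f n, g n)].
    For any [x], Baer's condition on the ideal of [r] with [r *: x] in the domain supplies a value
    at [x], so [B] is total. *)
Lemma baer_injective : baer E -> injective_module E.
Proof.
move=> baerE N M f finj g.
pose base : set (M * E) := [set p | exists n, p = (f n, g n)].
pose good (G : set (M * E)) :=
  [/\ base `<=` G,
      forall a p q, G p -> G q -> G (a *: p.1 + q.1, a *: p.2 + q.2) &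
      forall e, G (0, e) -> e = 0].
have base_good : good base.
  split=> //.
  - move=> a _ _ [n ->] [n' ->] /=; exists (a *: n + n').
    by rewrite !linearP.
  - move=> e [n [fn ->]].
    by rewrite (finj n 0) ?linear0 // -fn linear0.
(* The union of the empty chain is empty, so [base] is adjoined to each member rather than required
   in it. *)
have [F FP Ftot|A [Agood Amax]] :=
    @Zorn_bigcup (M * E)%type (fun G => good (base `|` G)).
  have [[G FG]|F0] := pselect (exists G, F G); last first.
    rewrite (_ : \bigcup_(X in F) X = set0) ?setU0 //.
    by apply/seteqP; split=> // p [X FX _]; apply: F0; exists X.
  have sub X : F X -> base `|` X `<=` base `|` \bigcup_(X in F) X.
    by move=> FX p [bp|Xp]; [left|right; exists X].
  have sup p q : (base `|` \bigcup_(X in F) X) p ->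
      (base `|` \bigcup_(X in F) X) q -> exists X, [/\ F X, (base `|` X) p & (base `|` X) q].
    move=> [bp|[X FX Xp]] [bq|[Y FY Yq]].
    - by exists G; split=> //; left.
    - by exists Y; split=> //; [left|right].
    - by exists X; split=> //; [right|left].
    - have [XY|YX] := Ftot _ _ FX FY.
        by exists Y; split=> //; right=> //; apply: XY.
      by exists X; split=> //; right=> //; apply: YX.
  split.
  - by move=> p bp; left.
  - move=> a p q /sup/[apply] -[X [FX Xp Xq]].
    by apply: (sub X FX); have [_ + _] := FP _ FX; apply.
  - move=> e Ge; have [X [FX Xe _]] := sup _ _ Ge Ge.
    by have [_ _] := FP _ FX; apply.
pose B := base `|` A.
have [baseB Bmul Bfun] : good B by [].
have Bmax G : good G -> B `<=` G -> G `<=` B.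
  move=> Ggood BG p Gp; apply: contrapT => Bp.
  apply: (Amax G); last first.
    by rewrite setUC setUidl //; exact: (subset_trans (@subsetUl _ _ _) BG).
  split; first by move=> q Aq; apply: BG; right.
  by move=> /(_ p Gp) Ap; apply: Bp; right.
have B0 : B (0, 0) by left; exists 0; rewrite !linear0.
have Bfst x e e' : B (x, e) -> B (x, e') -> e = e'.
  move=> Be Be'; apply/eqP; rewrite -subr_eq0; apply/eqP/Bfun.
  have := Bmul (-1) _ _ Be' Be; rewrite /= !scaleN1r addNr.
  by rewrite addrC.
have tot x : exists e, B (x, e).
  have [a p q /= Bp Bq|e|e0 e0P] := baerE [set p : R * E | B (p.1 *: x, p.2)].
  - by have := Bmul a _ _ Bp Bq; rewrite /= scalerA -scalerDl.
  - by rewrite /= scale0r => /Bfun.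
  exists e0.
  pose G : set (M * E) := [set p | exists r q, B q /\ p = (q.1 + r *: x, q.2 + r *: e0)].
  have BG : B `<=` G.
    by move=> [y t] By; exists 0, (y, t); rewrite !scale0r !addr0.
  apply: (Bmax G) => //; last first.
    by exists 1, (0, 0); rewrite /= !add0r !scale1r.
  split.
  - by move=> p /baseB/BG.
  - move=> a _ _ [r [q [Bq ->]]] [r' [q' [Bq' ->]]] /=.
    exists (a * r + r'), (a *: q.1 + q'.1, a *: q.2 + q'.2); split; first exact: Bmul.
    by rewrite /= !scalerDr !scalerDl !scalerA; congr (_, _); rewrite addrACA.
  (* Here [y + r *: x = 0], so [(r *: x, - t)] lies in [B] and [- t = r *: e0] by the choice of
     [e0]. *)
  - move=> e [r [[y t] [Bq [/eqP]]]] /=.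
    rewrite eq_sym addrC addr_eq0 => /eqP rx ->.
    have := Bmul (-1) _ _ Bq B0; rewrite /= !scaleN1r !addr0 -rx => /(e0P (r, - t)) /= <-.
    by rewrite subrr.
pose h x := sval (cid (tot x)).
have hP x : B (x, h x) by rewrite /h; case: cid.
have hl : linear h.
  move=> a x y; apply: (Bfst (a *: x + y)) => //.
  exact: (Bmul a _ _ (hP x) (hP y)).
exists (linear_of hl) => x; rewrite linear_ofE.
by apply: (Bfst (f x)) => //; left; exists x.
Qed.

(** One pair [(r, t)] with [r] nonzero fixes [e0] by [r *: e0 = t]. Cross-multiplying with another
    pair [(r', t')] gives [r *: t' = r' *: t], and torsion-freeness cancels [r]. *)
Lemma scaler_torsion_free_baer :
  divisible_module E -> (forall (r : R) (x : E), r *: x = 0 -> r = 0 \/ x = 0) -> baer E.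
Proof.
move=> divE tfE T Tmul Tfun.
have [[[r t] [/= r0 Trt]]|T0] := pselect (exists p : R * E, p.1 != 0 /\ T p); last first.
  exists 0 => -[r t] Tp /=; rewrite scaler0.
  have [r0|r0] := eqVneq r 0; first by apply: Tfun; rewrite -r0.
  by case: T0; exists (r, t).
have [e0 e0P] := divE r r0 t; exists e0 => -[r' t'] Tp /=.
have : T (0, 0) by have := Tmul (-1) _ _ Trt Trt; rewrite /= mulN1r scaleN1r !addNr.
move=> T0; have := Tmul (- r) _ _ Tp (Tmul r' _ _ Trt T0).
rewrite /= !addr0 mulNr (mulrC r') addNr => /Tfun.
rewrite -e0P scalerA mulrC -scalerA scaleNr -scalerN -scalerDr.
move=> /tfE[/eqP|/eqP]; first by rewrite (negbTE r0).
by rewrite addrC subr_eq0 => /eqP.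
Qed.

End Baer.

(** * The quotient field as an injective module *)

Section FractionModule.
Variable R : idomainType.

Lemma fracmod_scaleE (a : R) (x : fracmod R) : a *: x = tofrac a * x.
Proof. by []. Qed.

Lemma fracmod_numden (x : fracmod R) :
  exists a b : R, b != 0 /\ b *: x = tofrac a.
Proof.
elim/quotW: x => q; exists \n_q, \d_q; split; first exact: denom_ratioP.
rewrite fracmod_scaleE; unlock tofrac; rewrite !piE; apply/eqmodP.
rewrite /= FracField.equivfE /FracField.mulf !numden_Ratio ?mulf_neq0 ?oner_neq0 ?denom_ratioP //.
by rewrite mulr1 mul1r mulrC.
Qed.

Lemma fracmod_scaler_eq0 (a : R) (x : fracmod R) : a *: x = 0 -> a = 0 \/ x = 0.
Proof.
by move/eqP; rewrite fracmod_scaleE mulf_eq0 tofrac_eq0 => /orP[] /eqP; [left|right].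
Qed.

Lemma fracmod_scalerI (a : R) (x y : fracmod R) : a != 0 -> a *: x = a *: y -> x = y.
Proof.
move=> a0 /eqP; rewrite -subr_eq0 -scalerBr => /eqP/fracmod_scaler_eq0[/eqP|/eqP].
  by rewrite (negbTE a0).
by rewrite subr_eq0 => /eqP.
Qed.

Lemma tofrac_linear : linear (@tofrac R : R^o -> fracmod R).
Proof. by move=> a x y; rewrite tofracD tofracM. Qed.

Lemma tofrac_inj : injective (@tofrac R).
Proof. by move=> x y /eqP; rewrite tofrac_eq => /eqP. Qed.

Lemma ring_in_K0 : @ring_in_K R 0.
Proof. by exists 0; rewrite ?tofrac0. Qed.

Lemma ring_in_KD (a : R) x y :
  ring_in_K x -> ring_in_K y -> @ring_in_K R (a *: x + y).
Proof.
by move=> [r _ <-] [s _ <-]; exists (a * r + s); rewrite ?tofracD ?tofracM.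
Qed.

Lemma fracmod_div : divisible_module (fracmod R).
Proof.
move=> r r0 x; exists ((tofrac r)^-1 * x).
rewrite -[LHS]/(tofrac r * ((tofrac r)^-1 * x)) mulrA mulfV ?mul1r //.
by rewrite tofrac_eq0.
Qed.

Lemma fracmod_injective : injective_module (fracmod R).
Proof.
apply/baer_injective/scaler_torsion_free_baer; first exact: fracmod_div.
exact: fracmod_scaler_eq0.
Qed.

End FractionModule.

(** The first coordinates of [T] form an ideal of the integers, generated by its least positive
    element [d]; an [e0] with [d *: e0 = td] then serves for every pair. *)
Lemma divisible_int_injective (C : lmodType int) :
  divisible_module C -> injective_module C.
Proof.
move=> divC; apply: baer_injective => T Tmul Tfun.
have [[n [n0 [t Tn]]]|Tn] := pselect (exists n : nat, n != 0%N /\ exists t, T (n%:Z, t)).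
  have exn : exists n : nat, (n != 0%N) && `[< exists t, T (n%:Z, t) >].
    by exists n; rewrite n0; apply/asboolP; exists t.
  have [d /andP[d0 /asboolP[td Td]] dmin] := ex_minnP exn.
  have [e0 e0P] := divC d%:Z d0 td.
  have T0 : T (0, 0) by have := Tmul (-1) _ _ Td Td; rewrite /= mulN1r scaleN1r !addNr.
  exists e0 => -[r t'] Tr /=.
  have := divz_eq r d; have dz : d%:Z != 0 by [].
  have := modz_ge0 r dz; have := @ltz_pmod r d%:Z; rewrite ltz_nat lt0n d0.
  move: (r %/ d)%Z (r %% d)%Z => q [] // s /(_ isT) sd _ rE.
  have := Tmul (- q) _ _ Td Tr; rewrite /= rE mulNr addKr => Ts.
  have s0 : s = 0%N.
    apply: contrapT => /eqP s0.
    have /dmin : (s != 0%N) && `[< exists t, T (s%:Z, t) >].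
      by rewrite s0 /=; apply/asboolP; exists (- q *: td + t').
    by rewrite leqNgt -ltz_nat sd.
  move: Ts; rewrite s0 => /Tfun /eqP.
  by rewrite scaleNr addrC subr_eq0 addr0 -scalerA e0P => /eqP.
exists 0 => -[r t] Tr /=; rewrite scaler0; apply: Tfun.
suff -> : (0 : int) = r by [].
apply/esym/eqP; apply: contrapT => /negP r0; apply: Tn; exists `|r|%N.
rewrite absz_eq0; split=> //.
(* Closure of [T] adds one copy of the pair back, so the coefficient [sgz r - 1] turns [r] into its
   absolute value. *)
have := Tmul (sgz r - 1) _ _ Tr Tr; rewrite /= mulrBl mul1r subrK -abszEsg => Ta.
by exists ((sgz r - 1) *: t + t).
Qed.

(** * An injective cogenerator: the character module *)

Section CharacterModule.

Definition rat_integers : submodClosed (fracmod int) :=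
  submod_of (@ring_in_K0 int) (@ring_in_KD int).

Lemma rat_integersP x : reflect (@ring_in_K int x) (x \in rat_integers).
Proof. exact: submod_ofP. Qed.

Definition QmodZ := quotmod rat_integers.
HB.instance Definition _ := GRing.Lmodule.on QmodZ.

Lemma QmodZ_injective : injective_module QmodZ.
Proof.
apply: divisible_int_injective => r r0 z; have [x ->] := quot_proj_surj z.
have [y <-] := fracmod_div r0 x; exists (quot_proj _ y).
by rewrite -linearZ.
Qed.

(** The witness is the class of 1/d, which vanishes only if [d] divides 1. *)
Lemma QmodZ_order (d : nat) : (1 < d)%N ->
  exists2 c : QmodZ, d%:Z *: c = 0 & c != 0.
Proof.
move=> d1.
have d0 : tofrac d%:Z != 0 by rewrite tofrac_eq0; case: d d1.
exists (quot_proj _ ((tofrac d%:Z)^-1 : fracmod int)).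
  rewrite -linearZ -[RHS](linear0 (quot_proj rat_integers)); apply/quot_projP.
  apply/rat_integersP; exists 1 => //.
  rewrite subr0 -[_ *: _]/(tofrac d%:Z * (tofrac d%:Z)^-1).
  by rewrite mulfV // tofrac1.
rewrite -(linear0 (quot_proj rat_integers)).
apply/eqP => /quot_projP /rat_integersP[n _]; rewrite subr0 => nE.
have : tofrac (n * d%:Z) = tofrac 1 by rewrite tofracM nE mulVf // tofrac1.
move/eqP; rewrite tofrac_eq => /eqP nd.
have : (d%:Z %| 1)%Z by apply/dvdzP; exists n.
by rewrite dvdzE /= dvdn1 => /eqP d1'; rewrite d1' in d1.
Qed.

(** The cyclic group of [y] maps to Q/Z by sending [y] to a nonzero [c] killed by every integer that
    kills [y]; injectivity extends this map to [Y]. *)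
Lemma QmodZ_cogenerator (Y : lmodType int) (y : Y) : y != 0 ->
  exists h : {linear Y -> QmodZ}, h y != 0.
Proof.
move=> y0.
have [c c0 cP] : exists2 c : QmodZ, c != 0 & forall k : int, k *: y = 0 -> k *: c = 0.
  have [dex|nd] := pselect (exists d : nat, (d != 0%N) && (d%:Z *: y == 0)).
    have [d /andP[d0 /eqP dy] dmin] := ex_minnP dex.
    have [|c dc c0] := @QmodZ_order d.
      by case: d d0 dy {dmin} => [|[|d]] //; rewrite scale1r => _ /eqP; rewrite (negbTE y0).
    exists c => // k ky.
    have dz : d%:Z != 0 by [].
    have := divz_eq k d; have := modz_ge0 k dz; have := @ltz_pmod k d%:Z.
    rewrite ltz_nat lt0n d0.
    move: (k %/ d)%Z (k %% d)%Z => q [] // s /(_ isT) sd _ kE.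
    have s0 : s = 0%N.
      apply: contrapT => /eqP s0.
      have /dmin : (s != 0%N) && (s%:Z *: y == 0).
        rewrite s0 /=; move: ky; rewrite kE scalerDl -scalerA dy scaler0 add0r.
        by move=> ->.
      by rewrite leqNgt -ltz_nat sd.
    by rewrite kE s0 addr0 -scalerA dc scaler0.
  (* When [y] has infinite order any nonzero [c] serves. *)
  have [c _ c0] := @QmodZ_order 2 isT; exists c => // k ky.
  suff -> : k = 0 by rewrite scale0r.
  apply/eqP; apply: contrapT => /negP k0; apply: nd; exists `|k|%N.
  by rewrite absz_eq0 k0 abszEsg -scalerA ky scaler0 eqxx.
pose P : set Y := [set x | exists k : int, x = k *: y].
have P0 : P 0 by exists 0; rewrite scale0r.
have PD (a : int) x x' : P x -> P x' -> P (a *: x + x').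
  by move=> [k ->] [k' ->]; exists (a * k + k'); rewrite scalerDl scalerA.
pose N := submod_of P0 PD.
have kex (x : submod N) : exists k : int, val x = k *: y by have /(submod_ofP P0 PD) := valP x.
pose g x := sval (cid (kex x)) *: c.
have gP x k : val x = k *: y -> g x = k *: c.
  rewrite /g; case: cid => k' /= -> /eqP; rewrite -subr_eq0 -scalerBl => /eqP/cP.
  by move=> /eqP; rewrite scalerBl subr_eq0 => /eqP.
have gl : linear g.
  move=> a x x'; have [k xk] := kex x; have [k' xk'] := kex x'.
  rewrite (gP x k) // (gP x' k') // (gP _ (a * k + k')) ?scalerDl ?scalerA //.
  by rewrite linearP /= xk xk' scalerA.
have [h hP] := @QmodZ_injective _ _ (submod_incl N) val_inj (linear_of gl).
exists h.
have yN : y \in N by apply/(submod_ofP P0 PD); exists 1; rewrite scale1r.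
have /= -> := hP (Sub y yN).
by rewrite (gP _ 1) ?scale1r // SubK.
Qed.

Variable R : idomainType.

Definition is_additive_map : set (R -> QmodZ) :=
  [set phi : R -> QmodZ | {morph phi : x y / x + y}].

Lemma is_additive_map0 : is_additive_map 0.
Proof. by move=> x y; rewrite addr0. Qed.

Lemma is_additive_mapD (a : int) f g :
  is_additive_map f -> is_additive_map g -> is_additive_map (a *: f + g).
Proof. by move=> fD gD x y; rewrite !fctE fD gD scalerDr addrACA. Qed.

Definition additive_maps : submodClosed (R -> QmodZ) :=
  submod_of is_additive_map0 is_additive_mapD.

Lemma additive_mapsP phi :
  reflect (forall x y, phi (x + y) = phi x + phi y) (phi \in additive_maps).
Proof. exact: submod_ofP. Qed.

(* Hom_Z(R, Q/Z), with R acting on the argument. *)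
Definition char_module : Type := submod additive_maps.
HB.instance Definition _ := GRing.Zmodule.on char_module.

Definition char_fun (phi : char_module) : R -> QmodZ := val phi.

Lemma char_funD (phi : char_module) x y : char_fun phi (x + y) = char_fun phi x + char_fun phi y.
Proof. by have /additive_mapsP := valP phi; apply. Qed.

Lemma char_eq (phi psi : char_module) : char_fun phi =1 char_fun psi -> phi = psi.
Proof. by move=> e; apply/val_inj/funext. Qed.

Lemma char_of_subproof (phi : R -> QmodZ) :
  (forall x y, phi (x + y) = phi x + phi y) -> phi \in additive_maps.
Proof. by move=> h; apply/additive_mapsP. Qed.

Definition char_of (phi : R -> QmodZ) (h : forall x y, phi (x + y) = phi x + phi y) : char_module :=
  Sub phi (char_of_subproof h).

Lemma char_scale_subproof (a : R) (phi : char_module) x y :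
  char_fun phi (a * (x + y)) = char_fun phi (a * x) + char_fun phi (a * y).
Proof. by rewrite mulrDr char_funD. Qed.

Definition char_scale a phi := char_of (char_scale_subproof a phi).

Lemma char_scaleE a phi x : char_fun (char_scale a phi) x = char_fun phi (a * x).
Proof. by []. Qed.

Lemma char_fun_add phi psi x : char_fun (phi + psi) x = char_fun phi x + char_fun psi x.
Proof. by []. Qed.

Fact char_scaleA a b phi : char_scale a (char_scale b phi) = char_scale (a * b) phi.
Proof. by apply: char_eq => x; rewrite !char_scaleE mulrCA mulrA. Qed.

Fact char_scale1 : left_id 1 char_scale.
Proof. by move=> phi; apply: char_eq => x; rewrite char_scaleE mul1r. Qed.

Fact char_scaleDr : right_distributive char_scale +%R.
Proof. by move=> a phi psi; apply: char_eq. Qed.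

Fact char_scaleDl phi : {morph char_scale^~ phi : a b / a + b}.
Proof. by move=> a b; apply: char_eq => x; rewrite char_fun_add !char_scaleE mulrDl char_funD. Qed.

HB.instance Definition _ := GRing.Zmodule_isLmodule.Build R char_module
  char_scaleA char_scale1 char_scaleDr char_scaleDl.

Lemma char_funZ a (phi : char_module) x : char_fun (a *: phi) x = char_fun phi (a * x).
Proof. by []. Qed.

Lemma additive_int_linear (U : zmodType) (V : lmodType int) (f : U -> V) :
  {morph f : x y / x + y} -> linear (f : zmodule U -> V).
Proof.
move=> fD a x y; rewrite [LHS]fD; congr (_ + _).
have f0 : f 0 = 0 by apply: (addrI (f 0)); rewrite -fD !addr0.
have fn (n : nat) : f (x *+ n) = n%:Z *: f x.
  elim: n => [|n IHn]; first by rewrite scale0r.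
  by rewrite mulrS fD IHn -[RHS]/(_ *: _) -addn1 PoszD scalerDl scale1r addrC.
case: a => n; first exact: fn.
rewrite -[LHS]/(f (- (x *+ n.+1))) NegzE scaleNr -fn.
by apply: (addrI (f (x *+ n.+1))); rewrite -fD !subrr.
Qed.

(** Linear maps from [M] to [char_module] correspond to additive maps from [M] to Q/Z: evaluate at 1
    one way, send [m] to [r |-> h (r *: m)] the other way. Extension thus reduces to Q/Z. *)
Lemma char_module_injective : injective_module char_module.
Proof.
move=> N M f finj g.
have gD : {morph (fun n => char_fun (g n) 1) : x y / x + y}.
  by move=> x y; rewrite linearD.
have fD : {morph f : x y / x + y} by move=> x y; rewrite linearD.
pose f' := linear_of (@additive_int_linear N (zmodule M) f fD).
have [h hP] := @QmodZ_injective _ _ f' finj (linear_of (additive_int_linear gD)).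
have hD (m : M) (x y : R) : h ((x + y) *: m) = h (x *: m) + h (y *: m).
  by rewrite scalerDl (linearD h).
pose k (m : M) := char_of (hD m).
have kl : linear k.
  move=> a x y; apply: char_eq => r.
  rewrite char_fun_add char_funZ /char_fun /= scalerDr (linearD h).
  by rewrite scalerA mulrC.
exists (linear_of kl) => x; apply: char_eq => r.
rewrite linear_ofE {1}/char_fun /=.
have := hP (r *: x); rewrite /f' !linear_ofE [f _]linearZ /= => ->.
by rewrite linearZ char_funZ mulr1.
Qed.

Lemma char_module_cogenerator (Y : lmodType R) (y : Y) : y != 0 ->
  exists h : {linear Y -> char_module}, h y != 0.
Proof.
move=> y0; have [h hy] := @QmodZ_cogenerator (zmodule Y) y y0.
have hD (x : Y) (r s : R) : h ((r + s) *: x) = h (r *: x) + h (s *: x).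
  by rewrite scalerDl (linearD h).
have kl : linear (fun x => char_of (hD x)).
  move=> a x z; apply: char_eq => r.
  rewrite char_fun_add char_funZ /char_fun /= scalerDr (linearD h).
  by rewrite scalerA mulrC.
exists (linear_of kl); apply: contraNneq hy => /(congr1 (char_fun^~ 1)).
by rewrite /char_fun /= scale1r => ->.
Qed.

End CharacterModule.

(** * GV-ideals and w-ideals *)

Section GVIdeals.
Variable R : idomainType.
Implicit Types (I J : submodClosed R^o) (a b r : R).

(* J^-1 = R, stated without fractions for a/b in J^-1. *)
Definition GV_closed (J : submodClosed R^o) : Prop := forall a b, b != 0 ->
  (forall j : R, (j : R^o) \in J -> exists c, a * j = b * c) -> exists c, a = b * c.

Lemma GV_mapE J r (x : submod J) : GV_map J r x = r * val x.
Proof. by []. Qed.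

(** A linear [h] on [J] satisfies [h x * j0 = x * h j0], so it is multiplication by the fraction
    [h j0 / j0], which [GV_closed] places in R. A zero [J] is excluded because multiplications by 0
    and by 1 would agree on it. *)
Lemma GV_idealP J : GV_ideal J <->
  [/\ finitely_generated J, exists2 j : R, (j : R^o) \in J & j != 0 & GV_closed J].
Proof.
split=> [[fgJ [gv gvK gvK']]|[fgJ [j0 Jj0 nj0] cJ]].
  have [j Jj j0] : exists2 j : R, (j : R^o) \in J & j != 0.
    apply: contrapT => J0.
    have /eqP := oner_neq0 R; apply; apply: (can_inj gvK); apply: linear_eq => x.
    suff x0 : val x = 0 by rewrite !GV_mapE x0 !mulr0.
    by apply/eqP; apply: contrapT => /negP x0; apply: J0; exists (val x); first exact: valP.
  split=> //; first by exists j.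
  move=> a b b0 ab.
  have abex (x : submod J) : exists c, a * val x = b * c by exact: (ab _ (valP x)).
  pose h x : R^o := sval (cid (abex x)).
  have hP x : a * val x = b * h x by rewrite /h; case: cid.
  have hl : linear h.
    move=> k x y; apply: (mulfI b0); rewrite -hP.
    rewrite -[a * _]/(a * (k * val x + val y)) -[b * _]/(b * (k * h x + h y)).
    by rewrite !mulrDr -hP [b * _]mulrCA -hP mulrCA.
  exists (gv (linear_of hl)).
  have := linear_congr (gvK' (linear_of hl)) (Sub j Jj).
  have := hP (Sub j Jj); rewrite GV_mapE SubK linear_ofE => + E; rewrite -E.
  by move=> ajE; apply: (mulIf j0); rewrite ajE mulrA.
split=> //.
have sur (h : {linear submod J -> R^o}) : exists r, GV_map J r = h.
  have hj x : h x * j0 = (val x : R) * h (Sub j0 Jj0).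
    rewrite -[RHS]/(_ *: h _) -linearZ mulrC -[LHS]/(_ *: h x) -linearZ; congr (h _).
    by apply: val_inj; rewrite /= [LHS]mulrC.
  have [|c hc] := cJ (h (Sub j0 Jj0)) j0 nj0.
    by move=> j Jj; exists (h (Sub j Jj)); rewrite mulrC -(hj (Sub j Jj)) mulrC.
  exists c; apply: linear_eq => x; apply: (mulIf nj0); rewrite hj hc /=.
  by rewrite -[c *: _]/(c * (val x : R)) [RHS]mulrC -[RHS]mulrA [RHS]mulrC.
exists (fun h => sval (cid (sur h))) => [r|h]; last by case: cid.
case: cid => r' /= /linear_congr/(_ (Sub j0 Jj0)); rewrite !GV_mapE.
exact: mulIf.
Qed.

Lemma GV_unit : exists2 J, GV_ideal J & forall r, (r : R^o) \in J.
Proof.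
pose J : submodClosed R^o := generated [set x : R^o | x \in [:: 1 : R^o]].
have J1 : (1 : R^o) \in J by apply: mem_generated; rewrite /= inE.
have JT r : (r : R^o) \in J by rewrite -[r]mulr1; exact: (rpredZ r).
exists J => //; apply/GV_idealP; split.
- by exists [:: 1 : R^o].
- by exists 1; rewrite ?oner_neq0.
- by move=> a b b0 /(_ 1 J1)[c]; rewrite mulr1 => ->; exists c.
Qed.

(** This trades injective envelopes for a condition inside R. Forwards, K serves as the envelope of
    a nonzero [I]; backwards, the GV property turns an element of the w-envelope into an element of
    R. *)
Lemma w_idealP I : w_ideal I <-> forall J r, GV_ideal J ->
  (forall j : R, (j : R^o) \in J -> (j * r : R^o) \in I) -> (r : R^o) \in I.
Proof.
split=> [[tfI wI] J r GVJ JrI|wI].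
  have [_ [j Jj j0] _] := (GV_idealP J).1 GVJ.
  have [[c Ic c0]|I0] := pselect (exists2 c : R, (c : R^o) \in I & c != 0); last first.
    suff -> : r = 0 by rewrite rpred0.
    apply/eqP; rewrite -(mulrI_eq0 r (mulfI j0)).
    by apply: contrapT => /negP jr; apply: I0; exists (j * r); first exact: JrI.
  pose i : {linear submod I -> fracmod R} := linear_of (@tofrac_linear R) \o submod_incl I.
  have iE x : i x = @tofrac R (val x) by [].
  have envi : injective_envelope i.
    split.
    - by move=> x y; rewrite !iE => /tofrac_inj/val_inj.
    - exact: fracmod_injective.
    - move=> S [y Sy y0]; have [a [b [b0 ab]]] := fracmod_numden y.
      have Iac : (a * c : R^o) \in I by exact: (rpredZ a).
      have iac : i (Sub (a * c : R^o) Iac) = c *: (b *: y).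
        by rewrite iE -[LHS]/(@tofrac R (a * c)) tofracM mulrC ab.
      exists (Sub (a * c : R^o) Iac); rewrite iac; first by rewrite !rpredZ.
      by apply/eqP => /fracmod_scaler_eq0[|/fracmod_scaler_eq0[]]; exact/eqP.
  have : w_envelope (range i) (tofrac r).
    exists J => // k Jk; exists (Sub (k * r : R^o) (JrI _ Jk)) => //.
    by rewrite iE /= tofracM.
  rewrite (wI _ _ envi) => -[x _]; rewrite iE => /tofrac_inj <-.
  exact: valP.
split.
  move=> J x GVJ Jx; have [_ [j Jj j0] _] := (GV_idealP J).1 GVJ.
  have /(congr1 val)/= /eqP := Jx _ Jj.
  rewrite -[_ *: _]/(j * val x) mulf_eq0 (negbTE j0) /= => /eqP x0.
  exact: val_inj.
move=> E i [iinj injE essi]; apply/seteqP; split=> [x [J GVJ Jx]|x ix]; last first.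
  have [J GVJ JT] := GV_unit; exists J => // j _.
  by have [y _ <-] := ix; exists (j *: y) => //; rewrite linearZ.
have [_ [gv _ gvK]] := GVJ.
have iex (j : submod J) : exists y, i y = (val j : R) *: x.
  by have [y _ yE] := Jx _ (valP j); exists y.
(* The map [j |-> j *: x] lands in [I]; viewed in R it is multiplication by some [r], whose image is
   the candidate for [x]. *)
pose h j : R^o := val (sval (cid (iex j))).
have hP j (y : submod I) : i y = (val j : R) *: x -> h j = val y.
  by rewrite /h; case: cid => z /= <- /iinj ->.
have hl : linear h.
  move=> a j k; have [y yE] := iex j; have [z zE] := iex k.
  rewrite (hP _ _ yE) (hP _ _ zE) (hP _ (a *: y + z)) //.
  by rewrite linearP yE zE scalerA -scalerDl.
pose r := gv (linear_of hl).
have rP j : h j = r * val j.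
  by have := linear_congr (gvK (linear_of hl)) j; rewrite GV_mapE.
have Ir : (r : R^o) \in I.
  apply: (wI J) => // j Jj; have [y yE] := iex (Sub j Jj).
  have := hP _ _ yE; rewrite rP SubK mulrC => ->; exact: valP.
exists (Sub (r : R^o) Ir) => //.
apply/eqP; rewrite -subr_eq0; apply: contrapT => /negP e0.
(* The error [e] is killed by [J]. Were it nonzero, essentiality would give a nonzero element of [I]
   with image in [R e], killed by a nonzero [j], which is impossible in a domain. *)
set e := i _ - x in e0 *.
have Je (j : R) : (j : R^o) \in J -> j *: e = 0.
  move=> Jj; have [y yE] := iex (Sub j Jj).
  rewrite scalerBr -linearZ /= -[X in _ - X]yE; apply/eqP; rewrite subr_eq0.
  apply/eqP; congr (i _); apply: val_inj; have := hP _ _ yE; rewrite rP /= => <-.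
  exact: mulrC.
pose P : set E := [set y | exists k : R, y = k *: e].
have P0 : P 0 by exists 0; rewrite scale0r.
have PD (a : R) y y' : P y -> P y' -> P (a *: y + y').
  by move=> [k ->] [k' ->]; exists (a * k + k'); rewrite scalerDl scalerA.
have [|n /(submod_ofP P0 PD)[k nk] n0] := essi (submod_of P0 PD).
  by exists e => //; apply/(submod_ofP P0 PD); exists 1; rewrite scale1r.
have [_ [j Jj j0] _] := (GV_idealP J).1 GVJ.
have : i (j *: n) = i 0 by rewrite linearZ /= nk scalerA mulrC -scalerA Je // scaler0 linear0.
move/iinj/(congr1 val)/eqP; rewrite /= -[_ *: _]/(j * val n) mulf_eq0 (negbTE j0) /=.
by move=> /eqP nv; case/eqP: n0; rewrite -(linear0 i); congr (i _); apply: val_inj.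
Qed.

End GVIdeals.

(** * Maximal w-ideals *)

Section MaximalWIdeals.
Variable R : idomainType.
Implicit Types (I J A B m : submodClosed R^o).

(** [J] is the product ideal. If a/b sends it into R, then for [j] in [J1] the fraction a j / b
    sends [J2] into R, hence lies in R; so a/b sends [J1] into R and lies in R. *)
Lemma GV_mul J1 J2 : GV_ideal J1 -> GV_ideal J2 ->
  exists2 J, GV_ideal J & forall B,
    (forall j k : R, (j : R^o) \in J1 -> (k : R^o) \in J2 -> (j * k : R^o) \in B) ->
    {subset J <= B}.
Proof.
move=> /GV_idealP[[s1 s1P] [j1 J1j1 nj1] cJ1] /GV_idealP[[s2 s2P] [j2 J2j2 nj2] cJ2].
pose s : seq R^o := [seq (a : R) * (b : R) | a <- s1, b <- s2].
pose J : submodClosed R^o := generated [set x : R^o | x \in s].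
have s1J x : x \in s1 -> x \in J1 by move=> xs; rewrite s1P mem_generated.
have s2J x : x \in s2 -> x \in J2 by move=> xs; rewrite s2P mem_generated.
have mulJ (j k : R) : (j : R^o) \in J1 -> (k : R^o) \in J2 -> (j * k : R^o) \in J.
  pose P (k : R) : set R^o := [set x : R^o | ((x : R) * k : R^o) \in J].
  have P0 k' : P k' 0 by rewrite /P /= mul0r rpred0.
  have PD k' (a : R) x y : P k' x -> P k' y -> P k' (a *: x + y).
    by rewrite /P /= => Px Py; rewrite mulrDl -[a *: x]/(a * x) -mulrA rpredD // (rpredZ a).
  suff H (a : R) : (a : R^o) \in s1 -> {in J2, forall b, ((b : R) * a : R^o) \in J}.
    rewrite s1P => J1j J2k.
    apply/(submod_ofP (P0 k) (PD k)); apply: generated_min J1j => a as1.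
    by apply/(submod_ofP (P0 k) (PD k)); rewrite /P /= mulrC; exact: H.
  move=> as1 b; rewrite s2P => J2b.
  apply/(submod_ofP (P0 a) (PD a)); apply: generated_min J2b => c cs2.
  apply/(submod_ofP (P0 a) (PD a)); rewrite /P /= mulrC; apply: mem_generated => /=.
  by apply/allpairsP; exists (a, c).
exists J; last first.
  move=> B JB; apply: generated_min => x /allpairsP[[a b] /= [as1 bs2 ->]].
  by apply: JB; [exact: s1J|exact: s2J].
apply/GV_idealP; split; first by exists s.
- by exists (j1 * j2); [exact: mulJ|rewrite mulf_neq0].
- move=> a b b0 ab; apply: cJ1 => // j J1j; apply: cJ2 => // k J2k.
  by rewrite -mulrA; apply: ab; exact: mulJ.
Qed.

Lemma w_ideal_proper m J : w_ideal m -> (1 : R^o) \notin m -> GV_ideal J ->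
  exists2 j : R, (j : R^o) \in J & (j : R^o) \notin m.
Proof.
move=> /w_idealP wm m1 GVJ; apply: contrapT => Jm; case/negP: m1.
apply: (wm J) => // j Jj; rewrite mulr1; apply: contrapT => /negP mj.
by apply: Jm; exists j.
Qed.

(** For [b] outside [m], the [x] with [x * b] in [m] form a proper w-ideal above [m], which is [m]
    itself by maximality. *)
Lemma w_Max_prime m : w_Max m -> prime_ideal m.
Proof.
move=> [wm m1 mmax]; split=> // a b mab.
have [//|mb] := boolP ((b : R^o) \in m); rewrite ?orbT // orbF.
pose P : set R^o := [set x : R^o | ((x : R) * b : R^o) \in m].
have P0 : P 0 by rewrite /P /= mul0r rpred0.
have PD (k : R) x y : P x -> P y -> P (k *: x + y).
  by rewrite /P /= => Px Py; rewrite mulrDl -[k *: x]/(k * x) -mulrA rpredD // (rpredZ k).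
have pP := submod_ofP P0 PD.
apply: (mmax (submod_of P0 PD)).
- apply/w_idealP => J r GVJ Jr; apply/pP/((w_idealP m).1 wm J) => // j /Jr/pP.
  by rewrite /P /= mulrA.
- by apply/negP => /pP; rewrite /P /= mul1r; exact/negP.
- by move=> x mx; apply/pP; rewrite /P /= mulrC; exact: (rpredZ b).
- exact/pP.
Qed.

(* An ideal maximal among those containing no GV-ideal is a w-ideal, because
   GV-ideals are closed under products. *)
Lemma w_Max_above A : (forall J, GV_ideal J -> ~ {subset J <= A}) ->
  exists2 m, w_Max m & {subset A <= m}.
Proof.
move=> noGV.
pose good (G : set R^o) := [/\ [set x | x \in A] `<=` G,
  forall (a : R) x y, G x -> G y -> G (a *: x + y) &
  forall J, GV_ideal J -> exists2 x, x \in J & ~ G x].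
have goodA : good [set x | x \in A].
  split=> //.
  - by move=> a x y /= Ax Ay; rewrite rpredD // rpredZ.
  - move=> J /noGV JA; apply: contrapT => nJ; apply: JA => x Jx.
    by apply: contrapT => Ax; apply: nJ; exists x.
have [F FP Ftot|X [Xgood Xmax]] :=
    @Zorn_bigcup R^o (fun G => good ([set x | x \in A] `|` G)).
  have [[G FG]|F0] := pselect (exists G, F G); last first.
    rewrite (_ : \bigcup_(X in F) X = set0) ?setU0 //.
    by apply/seteqP; split=> // p [X FX _]; apply: F0; exists X.
  set A' := [set x | x \in A] in FP *.
  have sub X : F X -> A' `|` X `<=` A' `|` \bigcup_(X in F) X.
    by move=> FX p [bp|Xp]; [left|right; exists X].
  (* Finitely many elements of the union lie in one member of the chain. GV-ideals are finitely
     generated, so the union contains one only if a member does. *)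
  have sup (s : seq R^o) : {in s, forall x, (A' `|` \bigcup_(X in F) X) x} ->
      exists2 X, F X & {in s, forall x, (A' `|` X) x}.
    elim: s => [|x s IHs] sF; first by exists G.
    have [|X FX Xs] := IHs; first by move=> y ys; apply: sF; rewrite inE ys orbT.
    have [Ax|[Y FY Yx]] : (A' `|` \bigcup_(X in F) X) x by apply: sF; rewrite mem_head.
      by exists X => // y; rewrite inE => /predU1P[->|/Xs//]; left.
    have [XY|YX] := Ftot _ _ FX FY.
      exists Y => // y; rewrite inE => /predU1P[->|/Xs[Ay|Xy]]; [by right|by left|].
      by right; exact: XY.
    by exists X => // y; rewrite inE => /predU1P[->|/Xs//]; right; exact: YX.
  split.
  - by move=> x Ax; left.
  - move=> a x y Fx Fy.
    have [|X FX Xxy] := sup [:: x; y].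
      by move=> z; rewrite !inE => /orP[] /eqP ->.
    have [_ XD _] := FP _ FX.
    by apply: (sub X FX); apply: XD; apply: Xxy; rewrite !inE eqxx ?orbT.
  - move=> J GVJ; apply: contrapT => nJ.
    have JF x : x \in J -> (A' `|` \bigcup_(X in F) X) x.
      by move=> Jx; apply: contrapT => Fx; apply: nJ; exists x.
    have [[s sP] _] := GVJ.
    have [|X FX Xs] := sup s; first by move=> x xs; apply: JF; rewrite sP mem_generated.
    have [AX XD /(_ _ GVJ)[x Jx]] := FP _ FX; apply.
    have X0 : (A' `|` X) 0 by left; exact: rpred0.
    apply/(submod_ofP X0 XD); move: Jx; rewrite sP; apply: generated_min => y ys.
    by apply/(submod_ofP X0 XD)/Xs.
set B := [set x | x \in A] `|` X in Xgood.
have [AB BD Bno] := Xgood.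
have B0 : B 0 by left; exact: rpred0.
have bP := submod_ofP B0 BD.
have Bmax G : good G -> B `<=` G -> G `<=` B.
  move=> Ggood BG p Gp; apply: contrapT => Bp.
  apply: (Xmax G); last first.
    by rewrite setUC setUidl //; exact: (subset_trans (@subsetUl _ _ _) BG).
  split; first by move=> q Xq; apply: BG; right.
  by move=> /(_ p Gp) Xp; apply: Bp; right.
exists (submod_of B0 BD); last by move=> x Ax; apply/bP; left.
split.
- apply/w_idealP => J r GVJ Jr; apply/bP.
  (* If [r] is outside [B], maximality forces [B + R r] to contain a GV-ideal [J']. As [J r] lies in
     [B], so does the GV-ideal [J J'], a contradiction. *)
  pose G : set R^o := [set z | exists2 b : R^o, B b & exists k : R, z = b + k * r].
  have GB : B `<=` G by move=> b Bb; exists b => //; exists 0; rewrite mul0r addr0.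
  apply: contrapT => nBr; have nG : ~ good G.
    move=> /Bmax/(_ GB); apply: contra_not nBr; apply.
    by exists 0 => //; exists 1; rewrite mul1r add0r.
  apply: nG; split.
  + by move=> x /AB/GB.
  + move=> a _ _ [b Bb [k ->]] [b' Bb' [k' ->]]; exists (a *: b + b'); first exact: (BD a).
    exists (a * k + k'); rewrite -[a *: (b + k * r)]/(a * (b + k * r)) -[a *: b]/(a * b).
    by ring.
  + move=> J' GVJ'; apply: contrapT => nJ'.
    have J'G x : x \in J' -> G x.
      by move=> Jx; apply: contrapT => Gx; apply: nJ'; exists x.
    have [J2 GVJ2 J2min] := GV_mul GVJ GVJ'.
    have [x J2x] := Bno _ GVJ2; apply; apply/bP; apply: J2min J2x.
    move=> j k Jj /J'G[b Bb [l ->]]; rewrite mulrDr rpredD //.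
      exact/(rpredZ j)/bP.
    by rewrite mulrCA; apply: (rpredZ l); exact: Jr.
- have [J GVJ _] := GV_unit R; have [x Jx Bx] := Bno _ GVJ.
  apply/negP => /bP B1; apply: Bx.
  by have := BD x _ _ B1 B0; rewrite addr0 -[_ *: _]/(x * 1) mulr1.
- move=> I wI I1 BI x Ix; apply/bP; apply: (Bmax [set x | x \in I]) => //; last first.
    by move=> y By; apply/BI/bP.
  split.
  + by move=> y Ay; apply/BI/bP; left.
  + by move=> a y z /= Iy Iz; rewrite rpredD // rpredZ.
  + by move=> J GVJ; have [j Jj /negP Ij] := w_ideal_proper wI I1 GVJ; exists j.
Qed.

End MaximalWIdeals.

(** * Injectivity of a localized map *)

Section LocalInjectivity.
Variables (R : idomainType) (m : submodClosed R^o) (m_prime : prime_ideal m).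

Lemma prime_notinM (a b : R) :
  (a : R^o) \notin m -> (b : R^o) \notin m -> (a * b : R^o) \notin m.
Proof. by move=> am bm; apply/negP => /(proj2 m_prime); rewrite (negbTE am) (negbTE bm). Qed.

Variables (N M : lmodType R) (f : {linear N -> M}).

Lemma loc_map_injectiveP : injective (loc_map m_prime f) <->
  forall x, f x = 0 -> exists2 u : R, (u : R^o) \notin m & u *: x = 0.
Proof.
split=> [finj x fx|fker z t].
  pose one : denominators m := Sub (1 : R^o) (proj1 m_prime).
  have /finj/loc_fracP[u um] : loc_map m_prime f (loc_frac m_prime x one) =
      loc_map m_prime f (loc_frac m_prime 0 one) by rewrite !loc_mapE fx linear0.
  by rewrite scaler0 subr0 scale1r => ux; exists u.
have [x [s ->]] := loc_frac_surj z; have [y [r ->]] := loc_frac_surj t.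
rewrite !loc_mapE => /loc_fracP[u um].
rewrite -!linearZ -linearB -linearZ => /fker[v vm vE].
by apply/loc_fracP; exists (v * u); [exact: prime_notinM|rewrite -scalerA].
Qed.

End LocalInjectivity.

(** * Vanishing of sums of elementary tensors *)

Section TensorSums.
Variables (R : idomainType) (M L : lmodType R).

Lemma tens0l (l : L) : tens (0 : M) l = 0.
Proof. by rewrite -(scale0r (0 : M)) tensZl scale0r. Qed.

Lemma tens0r (x : M) : tens x (0 : L) = 0.
Proof. by rewrite -(scale0r (0 : L)) tensZr scale0r. Qed.

Lemma tens_suml I (s : seq I) (F : I -> M) (l : L) :
  tens (\sum_(i <- s) F i) l = \sum_(i <- s) tens (F i) l.
Proof. exact: (big_morph (fun x => tens x l) (fun x y => tensDl x y l) (tens0l l)). Qed.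

Lemma tens_sumr I (s : seq I) (F : I -> L) (x : M) :
  tens x (\sum_(i <- s) F i) = \sum_(i <- s) tens x (F i).
Proof. exact: (big_morph (tens x) (tensDr x) (tens0r x)). Qed.

Lemma tensor_sum (z : tensor M L) :
  exists s : seq (M * L), z = \sum_(p <- s) tens p.1 p.2.
Proof.
have [w ->] := quot_proj_surj z.
exists [seq (coeff p w *: p.1, p.2) | p <- dom w].
rewrite big_map -[in LHS](freeg_sumE w) linear_sum; apply: eq_bigr => p _ /=.
rewrite tensZl /tens -linearZ; congr (quot_proj _ _).
apply/eqP/freeg_eqP => q; rewrite coeff_fgscale !coeffU mul1r.
by case: p.
Qed.

Lemma tensor_linear_eq (P : lmodType R) (f g : {linear tensor M L -> P}) :
  (forall x l, f (tens x l) = g (tens x l)) -> f =1 g.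
Proof.
move=> fg z; have [s ->] := tensor_sum z.
by rewrite !linear_sum; apply: eq_bigr => p _; exact: fg.
Qed.

(* [a] has finite support and sum_l a(l) l = 0; asking this for every list
   containing [s] makes supports easy to enlarge. *)
Definition syzygy (a : L -> R) : Prop := exists s : seq L, forall s' : seq L,
  uniq s' -> {subset s <= s'} -> \sum_(l <- s') a l *: l = 0.

Definition single (x : M) (l : L) : L -> M := fun k => if k == l then x else 0.

(* M (x) L is the module of finitely supported functions L -> M modulo
   [syzygy_span]. *)
Definition syzygy_span : set (L -> M) := [set h | exists2 t : seq ((L -> R) * M),
  (forall c, c \in t -> syzygy c.1) & h = fun l => \sum_(c <- t) c.1 l *: c.2].

Lemma syzygy_span0 : syzygy_span 0.
Proof. by exists [::] => //; apply/funext => l; rewrite big_nil. Qed.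

Lemma syzygy_spanD (a : R) g h :
  syzygy_span g -> syzygy_span h -> syzygy_span (a *: g + h).
Proof.
move=> [s sP ->] [t tP ->]; exists ([seq (c.1, a *: c.2) | c <- s] ++ t).
  by move=> c; rewrite mem_cat => /orP[/mapP[c' /sP ? ->]|/tP].
apply/funext => l; rewrite big_cat big_map !fctE scaler_sumr; congr (_ + _).
by apply: eq_bigr => c _; rewrite /= !scalerA mulrC.
Qed.

Lemma sum_delta (s : seq L) (l : L) : uniq s -> l \in s ->
  \sum_(k <- s) (k == l)%:R *: k = l :> L.
Proof.
move=> us ls; rewrite (bigD1_seq l) //= eqxx scale1r big1 ?addr0 // => k /negbTE ->.
by rewrite scale0r.
Qed.

Let span := submod_of syzygy_span0 syzygy_spanD.
Let spanP := submod_ofP syzygy_span0 syzygy_spanD.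
Let b x l : quotmod span := quot_proj span (single x l).

Let bDl x x' l : b (x + x') l = b x l + b x' l.
Proof.
rewrite /b -linearD; congr (quot_proj _ _); apply/funext => k.
by rewrite /single fctE; case: eqP => // _; rewrite addr0.
Qed.

Let bZl a x l : b (a *: x) l = a *: b x l.
Proof.
rewrite /b -linearZ; congr (quot_proj _ _); apply/funext => k.
by rewrite /single fctE; case: eqP => // _; rewrite scaler0.
Qed.

(** The syzygy has coefficients 1, -1, -1 at [l + l'], [l], [l']; a sum of indicator functions also
    covers coincidences among these elements. *)
Let bDr x l l' : b x (l + l') = b x l + b x l'.
Proof.
rewrite /b -linearD; apply/quot_projP/spanP.
exists [:: (fun k => (k == l + l')%:R - (k == l)%:R - (k == l')%:R, x)].
  move=> c; rewrite inE => /eqP ->; exists [:: l + l'; l; l'] => s us sub /=.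
  under eq_bigr do rewrite !scalerBl.
  rewrite !sumrB !sum_delta ?sub ?inE ?eqxx ?orbT //.
  by rewrite addrAC addrK subrr.
apply/funext => k; rewrite big_seq1 /= /single !fctE !scalerBl opprD addrA.
by do 3 case: eqP => _; rewrite ?scale1r ?scale0r.
Qed.

Let bZr a x l : b x (a *: l) = a *: b x l.
Proof.
rewrite /b -linearZ; apply/quot_projP/spanP.
exists [:: (fun k => (k == a *: l)%:R - a * (k == l)%:R, x)].
  move=> c; rewrite inE => /eqP ->; exists [:: a *: l; l] => s us sub /=.
  under eq_bigr do rewrite !scalerBl -scalerA.
  by rewrite !sumrB -scaler_sumr !sum_delta ?sub ?inE ?eqxx ?orbT // subrr.
apply/funext => k; rewrite big_seq1 /= /single !fctE !scalerBl -scalerA.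
by do 2 case: eqP => _; rewrite ?scale1r ?scale0r ?scaler0.
Qed.

(** Sending [tens x l] to the class of [single x l] is well defined modulo [syzygy_span], so a
    vanishing sum has its coefficient function in that span. *)
Lemma tensor_sum_eq0 (s : seq (M * L)) : \sum_(p <- s) tens p.1 p.2 = 0 ->
  exists2 t : seq ((L -> R) * M), (forall c, c \in t -> syzygy c.1) &
    forall l, \sum_(p <- s) single p.1 p.2 l = \sum_(c <- t) c.1 l *: c.2.
Proof.
move=> /(congr1 (tensor_lift bDl bDr bZl bZr)); rewrite linear0 linear_sum.
under eq_bigr do rewrite tensor_liftE.
rewrite -linear_sum -[RHS](linear0 (quot_proj span)).
move=> /quot_projP /spanP; rewrite subr0 => -[t tP tE]; exists t => // l.
by rewrite -[RHS]/((fun l => \sum_(c <- t) c.1 l *: c.2) l) -tE fct_sumE.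
Qed.

Lemma sum_tens_single (s : seq (M * L)) (s' : seq L) : uniq s' ->
  {subset [seq p.2 | p <- s] <= s'} ->
  \sum_(l <- s') tens (\sum_(p <- s) single p.1 p.2 l) l = \sum_(p <- s) tens p.1 p.2.
Proof.
move=> us' ss'; under eq_bigr do rewrite tens_suml.
rewrite exchange_big /=; apply: eq_big_seq => p ps.
rewrite (bigD1_seq p.2) ?ss' ?map_f //= /single eqxx big1 ?addr0 // => l /negbTE ->.
exact: tens0l.
Qed.

End TensorSums.

(* Some entry of each finite nonzero family divides all the others in R_m. *)
Definition locally_valuation (R : idomainType) (m : submodClosed R^o) : Prop :=
  forall (T : eqType) (s : seq T) (a : T -> R), (exists2 l, l \in s & a l != 0) ->
  exists l0 (u : R) (c : T -> R), [/\ l0 \in s, (u : R^o) \notin m, a l0 != 0 &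
    {in s, forall l, u * a l = a l0 * c l}].

(** * Purity of embeddings of a divisible module *)

Section Purity.
Variables (R : idomainType) (m : submodClosed R^o) (m_prime : prime_ideal m).
Hypothesis valm : locally_valuation m.
Variables (D M : lmodType R) (f : {linear D -> M}).
Hypotheses (f_inj : injective f) (divD : divisible_module D).

(* Elimination of the first column with a pivot dividing that column only: the
   pivot need not divide its row, because D is divisible. *)
Lemma local_solution (T : eqType) (s : seq T) n (A : nat -> T -> R) (y : nat -> M)
    (d : T -> D) :
  {in s, forall l, f (d l) = \sum_(k < n) A k l *: y k} ->
  exists2 u : R, (u : R^o) \notin m & exists x : nat -> D,
    {in s, forall l, u *: d l = \sum_(k < n) A k l *: x k}.
Proof.
elim: n A y d => [|n IHn] A y d dA.
  exists 1; first by case: m_prime.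
  exists (fun=> 0) => l ls; rewrite big_ord0 scale1r.
  by apply: f_inj; rewrite dA // big_ord0 linear0.
have [[l ls al]|A0] := pselect (exists2 l, l \in s & A 0 l != 0); last first.
  have A0s l : l \in s -> A 0 l = 0.
    by move=> ls; apply/eqP; apply: contrapT => /negP al; apply: A0; exists l.
  have [|u um [x xP]] := IHn (A \o S) (y \o S) d.
    by move=> l ls; rewrite dA // big_ord_recl A0s // scale0r add0r.
  exists u => //; exists (fun k => if k is k'.+1 then x k' else 0) => l ls.
  by rewrite big_ord_recl /= scaler0 add0r xP.
have [l0 [u [c [l0s um al0 cP]]]] := valm (ex_intro2 _ _ l ls al).
(* As [u * A 0 l = A 0 l0 * c l], subtracting [c l] times row [l0] from [u] times row [l] removes
   the unknown [y 0]. *)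
pose A' k l := u * A k.+1 l - c l * A k.+1 l0.
have [|v vm [x xP]] := IHn A' (y \o S) (fun l => u *: d l - c l *: d l0).
  move=> k ks; have -> : f (u *: d k - c k *: d l0) = u *: f (d k) - c k *: f (d l0).
    by rewrite linearB !linearZ.
  rewrite !dA // !scaler_sumr -sumrB big_ord_recl /=.
  rewrite !scalerA -scalerBl cP // mulrC subrr scale0r add0r.
  by apply: eq_bigr => i _; rewrite !scalerA -scalerBl.
(* Row [l0], scaled by the [v] that the reduced system costs, is solved for its first unknown. *)
have [t tE] := divD al0 (v *: d l0 - \sum_(k < n) A k.+1 l0 *: x k).
exists (u * v); first exact: prime_notinM.
exists (fun k => u *: (if k is k'.+1 then x k' else t)) => k ks.
rewrite big_ord_recl /=.
have -> : A 0 k *: (u *: t) = c k *: (A 0 l0 *: t).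
  by rewrite !scalerA mulrC cP // mulrC.
have /eqP := xP k ks; rewrite scalerBr subr_eq => /eqP ukE.
have -> : \sum_(i < n) A (bump 0 i) k *: (u *: x (0 + i)%N) =
    c k *: (\sum_(i < n) A i.+1 l0 *: x i) + \sum_(i < n) A' i k *: x i.
  rewrite scaler_sumr -big_split; apply: eq_bigr => i _.
  by rewrite /= !scalerA -scalerDl /A' addrC subrK mulrC.
by rewrite mulrC -scalerA ukE tE scalerBr addrA subrK addrC !scalerA (mulrC v).
Qed.

(** If the image vanishes, the coefficients of [z], pushed to [M], are combinations of syzygies with
    unknowns in [M]. [local_solution] moves the unknowns into [D] at the price of [u], and the
    syzygies then kill [u *: z]. *)
Lemma tensor_map_ker_locally (L : lmodType R) (z : tensor D L) :
  tensor_map f L z = 0 -> exists2 u : R, (u : R^o) \notin m & u *: z = 0.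
Proof.
have [s0 ->] := tensor_sum z; rewrite linear_sum.
under eq_bigr do rewrite tensor_mapE.
rewrite -(big_map (fun p => (f p.1, p.2)) predT (fun p => tens p.1 p.2)).
move=> /tensor_sum_eq0[t tsyz tE].
have [s1 s1P] : exists s1 : seq L, forall s', uniq s' -> {subset s1 <= s'} ->
    {in t, forall c, \sum_(l <- s') c.1 l *: l = 0}.
  elim: t tsyz {tE} => [|c t IHt] tsyz; first by exists [::].
  have [|s1 s1P] := IHt; first by move=> c' tc'; apply: tsyz; rewrite inE tc' orbT.
  have [|s2 s2P] := tsyz c; first exact: mem_head.
  exists (s1 ++ s2) => s' us' sub c'; rewrite inE => /predU1P[->|].
    by apply: s2P => // l ls; apply: sub; rewrite mem_cat ls orbT.
  by apply: s1P => // l ls; apply: sub; rewrite mem_cat ls.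
pose s' := undup ([seq p.2 | p <- s0] ++ s1).
have us' : uniq s' by exact: undup_uniq.
pose c0 : (L -> R) * M := (fun=> 0, 0).
pose A k := (nth c0 t k).1.
have [|u um [x xP]] := @local_solution L s' (size t) A (fun k => (nth c0 t k).2)
    (fun l => \sum_(p <- s0) single p.1 p.2 l).
  move=> l _; have := tE l; rewrite big_map (big_nth c0) big_mkord => <-.
  rewrite linear_sum; apply: eq_bigr => p _ /=; rewrite /single.
  by case: eqP => // _; rewrite linear0.
exists u => //; rewrite -(@sum_tens_single _ _ _ _ s') //; last first.
  by move=> l ls; rewrite mem_undup mem_cat ls.
rewrite scaler_sumr.
under eq_big_seq => l ls do rewrite -tensZl xP // tens_suml.
rewrite exchange_big big1 // => k _.
under eq_bigr do rewrite tensZl -tensZr.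
rewrite -tens_sumr s1P ?tens0r ?mem_nth //.
by move=> l ls; rewrite mem_undup mem_cat ls orbT.
Qed.

Lemma tensor_map_locally_injective (L : lmodType R) : injective (loc_map m_prime (tensor_map f L)).
Proof. by apply/loc_map_injectiveP; exact: tensor_map_ker_locally. Qed.

End Purity.

(** * From PvMD to injectivity *)

Section PvMDForward.
Variable R : idomainType.

(** Since [I] is w-invertible, [I I^-1] is not inside [m], so some generator [a l0] and some [x] in
    [I^-1] have product [u] outside [m]. The cofactors are [c l = a l * x]. *)
Lemma PvMD_locally_valuation (m : submodClosed R^o) :
  PvMD R -> w_Max m -> locally_valuation m.
Proof.
move=> pvmd [wm m1 _] T s a [l ls al].
pose I : submodClosed R^o := generated [set x : R^o | x \in [seq a l : R^o | l <- s]].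
have Ia k : k \in s -> (a k : R^o) \in I.
  by move=> ks; apply: mem_generated; exact: map_f.
have wI : w_invertible I.
  by apply: pvmd; [exists [seq a l : R^o | l <- s]|exists (a l); first exact: Ia].
have [l0 [x [u [l0s Ix um xu]]]] : exists l0 x (u : R), [/\ l0 \in s, ideal_inverse I x,
    (u : R^o) \notin m & a l0 *: x = tofrac u].
  apply: contrapT => none.
  have : @ring_in_K R (tofrac 1 : fracmod R) by exists 1.
  rewrite -wI => -[J GVJ J1].
  have [j Jj mj] := w_ideal_proper wm m1 GVJ.
  pose W : set (fracmod R) := [set z | exists2 e : R, (e : R^o) \in m & z = tofrac e].
  have W0 : W 0 by exists 0; rewrite ?rpred0 ?tofrac0.
  have WD (k : R) y z : W y -> W z -> W (k *: y + z).
    move=> [e me ->] [e' me' ->]; exists (k * e + e'); last by rewrite tofracD tofracM.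
    by rewrite rpredD // (rpredZ k).
  have : W (j *: (tofrac 1 : fracmod R)).
    have J1j : (j *: (tofrac 1 : fracmod R)) \in generated _ := J1 _ Jj.
    apply/(submod_ofP W0 WD); apply: generated_min J1j.
    move=> _ [b [x [Ib Ix ->]]].
    pose V : set R^o := [set c : R^o | W ((c : R) *: x)].
    have V0 : V 0 by rewrite /V /= scale0r.
    have VD (k : R) y z : V y -> V z -> V (k *: y + z).
      by rewrite /V /= => Vy Vz; rewrite scalerDl -scalerA; exact: WD.
    apply/(submod_ofP W0 WD)/(submod_ofP V0 VD); apply: generated_min Ib.
    move=> _ /mapP[l0 l0s ->]; apply/(submod_ofP V0 VD).
    have [e _ eE] := Ix _ (Ia _ l0s).
    exists e => //; apply: contrapT => /negP me.
    by apply: none; exists l0, x, e.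
  move=> [e me]; rewrite -[_ *: _]/(tofrac j * tofrac 1) tofrac1 mulr1.
  by move=> /tofrac_inj je; rewrite je me in mj.
(* Off [s] the cofactor is a dummy. *)
have cex k : exists c : R, k \in s -> a k *: x = tofrac c.
  have [ks|] := boolP (k \in s); last by exists 0.
  by have [c _ cE] := Ix _ (Ia _ ks); exists c.
exists l0, u, (fun k => sval (cid (cex k))); split=> //.
  apply: contraNneq um => al0; move: xu; rewrite al0 scale0r -tofrac0.
  by move=> /tofrac_inj <-; exact: rpred0.
move=> k ks; case: cid => c /= /(_ ks) kE; apply: tofrac_inj.
by rewrite !tofracM -xu -kE !fracmod_scaleE; ring.
Qed.

(** [Q] is the pushout of [f] and [g]. The map [i] from [E] to [Q] is injective because [f] is,
    hence w-pure because [E] is divisible. A retraction of [i], composed with [M -> Q], extends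
    [g]. *)
Lemma PvMD_divisible_injective (E : lmodType R) :
  PvMD R -> pure_w_injective E -> divisible_module E -> injective_module E.
Proof.
move=> pvmd pwiE divE N M f finj g.
pose P : set (E * M) := [set p | exists n, p = (g n, - f n)].
have P0 : P 0 by exists 0; rewrite !linear0.
have PD (k : R) y z : P y -> P z -> P (k *: y + z).
  move=> [n ->] [n' ->]; exists (k *: n + n').
  by rewrite (linearP g) (linearP f) opprD -scalerN.
pose Q := quotmod (submod_of P0 PD).
have il : linear (fun e : E => quot_proj (submod_of P0 PD) (e, 0)).
  move=> k x y; rewrite -linearP; congr (quot_proj _ _).
  by congr (_, _); rewrite /= scaler0 addr0.
have jl : linear (fun x : M => quot_proj (submod_of P0 PD) (0, x)).
  move=> k x y; rewrite -linearP; congr (quot_proj _ _).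
  by congr (_, _); rewrite /= scaler0 addr0.
pose i : {linear E -> Q} := linear_of il.
have iinj : injective i.
  move=> x y /quot_projP /(submod_ofP P0 PD)[n [xy]].
  rewrite /= subr0 => /eqP; rewrite eq_sym oppr_eq0 => /eqP fn.
  have n0 : n = 0 by apply: finj; rewrite linear0.
  by move: xy; rewrite n0 linear0 => /eqP; rewrite subr_eq0 => /eqP.
have [||r rP] := pwiE _ _ i _ _ (idfun : {linear E -> E}).
- move=> m mp _; apply/loc_map_injectiveP => x ix; exists 1; first by case: mp.
  by rewrite scale1r; apply: iinj; rewrite linear0.
- move=> L m mp wm; apply: tensor_map_locally_injective => //; exact: PvMD_locally_valuation.
exists (r \o linear_of jl) => n /=; rewrite -[RHS](rP (g n)); congr (r _).
apply/quot_projP/(submod_ofP P0 PD); exists (- n).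
by rewrite (linearN g) (linearN f) opprK -[LHS]/(0 - g n, f n - 0) sub0r subr0.
Qed.

End PvMDForward.

(** * Modules of homomorphisms *)

Section HomModule.
Variables (R : idomainType) (X E : lmodType R).

Lemma linear_closed0 : linear (0 : X -> E).
Proof. by move=> a x y; rewrite -[RHS]/(a *: (0 : E) + 0) scaler0 addr0. Qed.

Lemma linear_closedD (k : R) (f g : X -> E) : linear f -> linear g -> linear (k *: f + g).
Proof.
move=> fl gl a x y; rewrite !fctE fl gl scalerDr addrACA scalerDr.
by congr (_ + _ + _); rewrite !scalerA mulrC.
Qed.

Definition hom_module : Type := submod (submod_of linear_closed0 linear_closedD).
HB.instance Definition _ := GRing.Lmodule.on hom_module.

Definition hom_fun (f : hom_module) : {linear X -> E} :=
  linear_of (elimT (submod_ofP linear_closed0 linear_closedD _) (valP f)).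

Definition hom_of (f : X -> E) (fl : linear f) : hom_module :=
  Sub f (introT (submod_ofP linear_closed0 linear_closedD _) fl).

Lemma hom_ofE f (fl : linear f) x : hom_fun (hom_of fl) x = f x.
Proof. by []. Qed.

Lemma hom_eq (f g : hom_module) : hom_fun f =1 hom_fun g -> f = g.
Proof. by move=> fg; apply/val_inj/funext. Qed.

Lemma hom_funP (a : R) (f g : hom_module) x :
  hom_fun (a *: f + g) x = a *: hom_fun f x + hom_fun g x.
Proof. by []. Qed.

Lemma hom_funZ (a : R) (f : hom_module) x : hom_fun (a *: f) x = a *: hom_fun f x.
Proof. by []. Qed.

Hypothesis injE : injective_module E.

(** Multiplication by [r] embeds [X] in itself, and an extension [h] of [f] along it satisfies
    [r *: h = f]. *)
Lemma hom_module_divisible :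
  (forall (r : R) (x : X), r != 0 -> r *: x = 0 -> x = 0) -> divisible_module hom_module.
Proof.
move=> tfX r r0 f.
have rl : linear (fun x : X => r *: x).
  by move=> a x y; rewrite scalerDr !scalerA mulrC.
have rinj : injective (linear_of rl).
  move=> x y /eqP; rewrite !linear_ofE -subr_eq0 -scalerBr => /eqP/(tfX _ _ r0)/eqP.
  by rewrite subr_eq0 => /eqP.
have [h hP] := injE rinj (hom_fun f).
have hl : linear h by move=> a x y; rewrite linearP.
exists (hom_of hl); apply: hom_eq => x.
by rewrite hom_funZ hom_ofE -hP linear_ofE linearZ.
Qed.

(** By adjunction, [g] extends along [f] once a map to [E] extends along [tensor_map f X]. Purity
    makes the latter injective only locally at [m], but the complement of [m] acts invertibly on
    [X], hence on the tensor product, so it is injective outright. *)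
Lemma hom_module_pure_w_injective (m : submodClosed R^o) : w_Max m ->
  (forall u : R, (u : R^o) \notin m ->
     exists v : {linear X -> X}, forall x, v (u *: x) = x) ->
  pure_w_injective hom_module.
Proof.
move=> maxm divX N M f _ puref g.
have mp := w_Max_prime maxm.
have fXinj : injective (tensor_map f X).
  apply: raddf_inj => z /((loc_map_injectiveP mp _).1 (puref X m mp maxm))[u um uz].
  have [v vu] := divX u um.
  have vDl (n n' : N) x : tens (n + n') (v x) = tens n (v x) + tens n' (v x) by exact: tensDl.
  have vDr (n : N) x x' : tens n (v (x + x')) = tens n (v x) + tens n (v x').
    by rewrite linearD tensDr.
  have vZl a (n : N) x : tens (a *: n) (v x) = a *: tens n (v x) by exact: tensZl.
  have vZr a (n : N) x : tens n (v (a *: x)) = a *: tens n (v x).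
    by rewrite linearZ tensZr.
  pose w := tensor_lift vDl vDr vZl vZr.
  have wK : (u \*: w) =1 (idfun : {linear tensor N X -> tensor N X}).
    apply: tensor_linear_eq => n x.
    rewrite -[LHS]/(u *: w (tens n x)) [w _](tensor_liftE vDl vDr vZl vZr).
    by rewrite -tensZr -linearZ vu.
  by have := wK z; rewrite -[LHS]/(u *: w z) -(linearZ_LR w) uz linear0.
have gDl (n n' : N) x : hom_fun (g (n + n')) x = hom_fun (g n) x + hom_fun (g n') x.
  by rewrite linearD.
have gDr (n : N) x x' : hom_fun (g n) (x + x') = hom_fun (g n) x + hom_fun (g n) x'.
  by rewrite linearD.
have gZl a (n : N) x : hom_fun (g (a *: n)) x = a *: hom_fun (g n) x.
  by rewrite linearZ.
have gZr a (n : N) x : hom_fun (g n) (a *: x) = a *: hom_fun (g n) x.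
  by rewrite linearZ.
have [k kP] := injE fXinj (tensor_lift gDl gDr gZl gZr).
have kl (y : M) : linear (fun x : X => k (tens y x)).
  by move=> a x x'; rewrite tensDr tensZr linearP.
have hl : linear (fun y : M => hom_of (kl y)).
  by move=> a y y'; apply: hom_eq => x; rewrite hom_funP !hom_ofE tensDl tensZl linearP.
exists (linear_of hl) => n; apply: hom_eq => x.
transitivity (k (tensor_map f X (tens n x))); first by rewrite tensor_mapE.
by rewrite kP; exact: tensor_liftE.
Qed.

End HomModule.

(** * Comparability of two elements in R_m *)

Section Comparability.
Variables (R : idomainType) (m : submodClosed R^o).
Hypothesis maxm : w_Max m.
Hypothesis divinj : forall E : lmodType R,
  pure_w_injective E -> divisible_module E -> injective_module E.
Variables a b : R.

Let mp := w_Max_prime maxm.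

(* a R_m + b R_m *)
Definition local_span : set (fracmod R) := [set z : fracmod R | exists u r s : R,
  (u : R^o) \notin m /\ u *: z = tofrac (r * a + s * b)].

Lemma local_span0 : local_span 0.
Proof.
exists 1, 0, 0; split; first by case: mp.
by rewrite scaler0 !mul0r addr0 tofrac0.
Qed.

Lemma local_spanD (k : R) y z : local_span y -> local_span z -> local_span (k *: y + z).
Proof.
move=> [u [r [s [um uy]]]] [v [r' [s' [vm vz]]]].
exists (u * v), (v * k * r + u * r'), (v * k * s + u * s').
split; first exact: prime_notinM.
rewrite scalerDr scalerA.
have -> : (u * v * k) *: y = (v * k) *: (u *: y) by rewrite scalerA; congr (_ *: _); ring.
rewrite -(scalerA u v z) vz uy !fracmod_scaleE -!tofracM -tofracD; congr tofrac.
by ring.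
Qed.

Let XS := submod_of local_span0 local_spanD.
Let XSP := submod_ofP local_span0 local_spanD.
Local Notation X := (submod XS).

Let X_divisible (u : R) : (u : R^o) \notin m ->
  exists v : {linear X -> X}, forall x, v (u *: x) = x.
Proof.
move=> um.
have u0 : @tofrac R u != 0.
  by rewrite tofrac_eq0; apply: contraNneq um => ->; exact: rpred0.
have divP (x : X) : ((tofrac u)^-1 * val x : fracmod R) \in XS.
  have /XSP[w [r [s [wm wx]]]] := valP x; apply/XSP.
  exists (w * u), r, s; split; first exact: prime_notinM.
  by rewrite fracmod_scaleE tofracM -mulrA mulVKf.
have vl : linear (fun x : X => Sub ((tofrac u)^-1 * val x : fracmod R) (divP x) : X).
  move=> k x y; apply: val_inj.
  rewrite -[LHS]/((tofrac u)^-1 * (tofrac k * val x + val y)).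
  by rewrite mulrDr mulrCA.
exists (linear_of vl) => x; apply: val_inj.
by rewrite -[LHS]/((tofrac u)^-1 * (tofrac u * val x)) mulKf.
Qed.

(* m X *)
Let max_multiples : set X := [set x | exists u r s : R,
  [/\ (u : R^o) \notin m, (r : R^o) \in m, (s : R^o) \in m &
      u *: (val x : fracmod R) = tofrac (r * a + s * b)]].

Let max_multiples0 : max_multiples 0.
Proof.
exists 1, 0, 0; split; rewrite ?rpred0 //; first by case: mp.
by rewrite scaler0 !mul0r addr0 tofrac0.
Qed.

Let idealM (x y : R) : (y : R^o) \in m -> (x * y : R^o) \in m.
Proof. exact: (rpredZ x). Qed.

Let max_multiplesD (k : R) y z :
  max_multiples y -> max_multiples z -> max_multiples (k *: y + z).
Proof.
move=> [u [r [s [um rm sm uy]]]] [v [r' [s' [vm rm' sm' vz]]]].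
exists (u * v), (v * k * r + u * r'), (v * k * s + u * s').
split; try exact: prime_notinM; try by rewrite rpredD // idealM.
rewrite -[val _]/(k *: (val y : fracmod R) + val z) scalerDr scalerA.
have -> : (u * v * k) *: (val y : fracmod R) = (v * k) *: (u *: (val y : fracmod R)).
  by rewrite scalerA; congr (_ *: _); ring.
rewrite -(scalerA u v (val z : fracmod R)) vz uy !fracmod_scaleE -!tofracM -tofracD; congr tofrac.
by ring.
Qed.

(** Suppose neither divides the other in R_m. That [a] does not divide [b] makes the class of [b] in
    X/mX nonzero; that [b] does not divide [a] makes [g] well defined. *)
Lemma locally_comparable :
  (exists u c : R, (u : R^o) \notin m /\ u * a = b * c) \/
  (exists u c : R, (u : R^o) \notin m /\ u * b = a * c).
Proof.
apply: contrapT => /not_orP[na nb].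
have m1 : (1 : R^o) \notin m by case: mp.
pose ZP := submod_ofP max_multiples0 max_multiplesD.
have Xa : (tofrac a : fracmod R) \in XS.
  by apply/XSP; exists 1, 1, 0; rewrite scale1r mul1r mul0r addr0.
have Xb : (tofrac b : fracmod R) \in XS.
  by apply/XSP; exists 1, 0, 1; rewrite scale1r mul1r mul0r add0r.
pose aX : X := Sub (tofrac a : fracmod R) Xa.
pose bX : X := Sub (tofrac b : fracmod R) Xb.
pose pr := quot_proj (submod_of max_multiples0 max_multiplesD).
(* From [u * b = r * a + s * b] with [r], [s] in [m] follows [(u - s) * b = a * r] with [u - s]
   outside [m]. *)
have bX0 : pr bX != 0.
  rewrite -(linear0 pr); apply/eqP => /quot_projP/ZP; rewrite subr0.
  move=> [u [r [s [um rm sm]]]]; rewrite -[_ *: _]/(tofrac u * tofrac b) -tofracM.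
  move=> /tofrac_inj ub; apply: nb; exists (u - s), r; split.
    by apply: contra um => usm; rewrite -(subrK s u) rpredD.
  by rewrite mulrBl ub addrK mulrC.
have [h hb] := char_module_cogenerator bX0.
pose E := char_module R.
pose mu : {linear X -> E} := h \o pr.
have mul : linear mu by move=> k x y; rewrite linearP.
pose muD : hom_module X E := hom_of mul.
have mu0 (c : R) : (c : R^o) \in m -> c *: muD = 0.
  move=> cm; apply: hom_eq => x; rewrite hom_funZ hom_ofE -linearZ.
  suff prx : pr (c *: x) = 0 by rewrite -[LHS]/(h (pr (c *: x))) prx linear0.
  rewrite -(linear0 pr); apply/quot_projP/ZP; rewrite subr0.
  have /XSP[u [r [s [um ux]]]] := valP x.
  exists u, (c * r), (c * s); split=> //; try by rewrite mulrC idealM.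
  rewrite -[val _]/(c *: (val x : fracmod R)) scalerA mulrC -scalerA ux.
  by rewrite fracmod_scaleE -tofracM mulrDr !mulrA.
pose P : set R^o := [set n : R^o | exists s r : R, n = s * a + r * b].
have P0 : P 0 by exists 0, 0; rewrite !mul0r addr0.
have PD (k : R) x y : P x -> P y -> P (k *: x + y).
  move=> [s [r ->]] [s' [r' ->]]; exists (k * s + s'), (k * r + r').
  by rewrite -[_ *: _]/(k * (s * a + r * b)); ring.
pose N := submod_of P0 PD.
have sex (n : submod N) : exists s r : R, val n = s * a + r * b.
  exact/(submod_ofP P0 PD)/(valP n).
pose g n := sval (cid (sex n)) *: muD.
(* Two expressions of [n] give [(s' - s) * a = b * (r - r')], so [s' - s] lies in [m], which kills
   [muD]. *)
have gP n (s r : R) : val n = s * a + r * b -> g n = s *: muD.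
  rewrite /g; case: cid => s' /= [r' ->] E1.
  apply/eqP; rewrite -subr_eq0 -scalerBl; apply/eqP/mu0.
  apply: contrapT => /negP ssm; apply: na; exists (s' - s), (r - r'); split=> //.
  apply/eqP; rewrite mulrBl subr_eq addrC -subr_eq0; apply/eqP.
  move/eqP: E1; rewrite -subr_eq0 => /eqP <-; ring.
have gl : linear g.
  move=> k x y; have [s [r xE]] := sex x; have [s' [r' yE]] := sex y.
  rewrite (gP _ _ _ xE) (gP _ _ _ yE) (gP _ (k * s + s') (k * r + r')).
    by rewrite scalerDl scalerA.
  rewrite -[LHS]/(k * (val x : R) + (val y : R)) xE yE; ring.
have pwiD := hom_module_pure_w_injective (@char_module_injective R) maxm X_divisible.
have divD : divisible_module (hom_module X E).
  apply: hom_module_divisible; first exact: char_module_injective.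
  move=> r x r0 /(congr1 val) rx; apply: val_inj.
  by have [/eqP|//] := fracmod_scaler_eq0 rx; rewrite (negbTE r0).
have [t tP] := @divinj (hom_module X E) pwiD divD (submod N) R^o (submod_incl N)
  val_inj (linear_of gl).
have Na : (a : R^o) \in N by apply/(submod_ofP P0 PD); exists 1, 0; ring.
have Nb : (b : R^o) \in N by apply/(submod_ofP P0 PD); exists 0, 1; ring.
have ta : t a = muD.
  transitivity (g (Sub (a : R^o) Na)); first exact: (tP (Sub (a : R^o) Na)).
  rewrite (gP _ 1 0) ?scale1r // SubK; ring.
have tb : t b = 0.
  transitivity (g (Sub (b : R^o) Nb)); first exact: (tP (Sub (b : R^o) Nb)).
  rewrite (gP _ 0 1) ?scale0r // SubK; ring.
have tZ (c : R) : t c = c *: t 1.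
  by rewrite -linearZ; congr (t _); rewrite -[RHS]/(c * 1) mulr1.
(* The value of [muD] at [bX] is that of [t 1] at [a *: bX = b *: aX], which is the value of
   [t b = 0] at [aX]. *)
case/eqP: hb; rewrite -[LHS]/(hom_fun muD bX) -ta tZ hom_funZ -linearZ.
have -> : a *: bX = b *: aX.
  apply: val_inj; rewrite -[LHS]/(tofrac a * tofrac b) -[RHS]/(tofrac b * tofrac a).
  exact: mulrC.
by rewrite (linearZ_LR (hom_fun (t 1))) -hom_funZ -tZ tb.
Qed.

End Comparability.

(** * From injectivity to PvMD *)

Section PvMDConverse.
Variable R : idomainType.
Hypothesis divinj : forall E : lmodType R,
  pure_w_injective E -> divisible_module E -> injective_module E.

(** By induction on [s], each new element is compared in R_m with the pivot found so far, and
    whichever divides the other is kept. *)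
Lemma local_pivot (m : submodClosed R^o) (s : seq R) : w_Max m ->
  (exists2 a, a \in s & a != 0) ->
  exists a u : R, [/\ a \in s, a != 0, (u : R^o) \notin m &
    forall b, b \in s -> exists c, u * b = a * c].
Proof.
move=> maxm; have mp := w_Max_prime maxm.
elim: s => [[]//|x s IHs [a]].
rewrite inE => axs a0.
have [/IHs[y [u [ys y0 um yP]]]|s0] := pselect (exists2 a, a \in s & a != 0).
  have [[v [c [vm vx]]]|[v [c [vm vy]]]] := locally_comparable maxm divinj x y.
    exists y, (u * v); split=> //; [by rewrite inE ys orbT|exact: prime_notinM|].
    move=> b; rewrite inE => /predU1P[->|/yP[d bd]].
      by exists (u * c); rewrite -mulrA vx mulrCA.
    by exists (v * d); rewrite mulrAC bd -mulrA (mulrC v).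
  exists x, (u * v); split; [by rewrite inE eqxx| |exact: prime_notinM|].
    (* The new pivot [x] is nonzero because it divides the nonzero [v * y]. *)
    apply: contraNneq vm => x0; move: vy; rewrite x0 mul0r => /eqP.
    by rewrite mulf_eq0 (negbTE y0) orbF => /eqP ->; exact: rpred0.
  move=> b; rewrite inE => /predU1P[->|/yP[d bd]]; first by exists (u * v); rewrite mulrC.
  by exists (c * d); rewrite (mulrC u) -mulrA bd mulrA vy mulrA.
have ax : a = x.
  by case/predU1P: axs => // asn; case: s0; exists a.
exists x, 1; split; [by rewrite inE eqxx|by rewrite -ax|by case: mp|].
move=> b; rewrite inE => /predU1P[->|bs]; first by exists 1; rewrite mulrC.
exists 0; rewrite mulr0 mul1r; apply/eqP; apply: contrapT => /negP b0.
by apply: s0; exists b.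
Qed.

(** If [I I^-1] contained no GV-ideal, some [m] in w-Max(R) would contain it. A pivot [a] of the
    generators at [m] puts [u / a] in [I^-1], so [u] lies in [I I^-1] but not in [m], a
    contradiction. *)
Lemma divisible_injective_PvMD : PvMD R.
Proof.
move=> I [s sP] [a0 Ia0 na0].
have s0 : exists2 a : R, a \in s & a != 0.
  apply: contrapT => s0; case/eqP: na0.
  rewrite sP in Ia0; apply: (generated_ker (f := idfun : {linear R^o -> R^o})) Ia0.
  move=> y /= ys; apply/eqP; apply: contrapT => /negP y0.
  by apply: s0; exists y.
pose P : set R^o := [set r : R^o | (tofrac (r : R) : fracmod R) \in ideal_mul_inverse I].
have P0 : P 0 by rewrite /P /= tofrac0; exact: rpred0.
have PD (k : R) x y : P x -> P y -> P (k *: x + y).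
  by rewrite /P /= => Px Py; rewrite tofracD tofracM rpredD // (rpredZ k).
have PP := submod_ofP P0 PD.
have QP := submod_ofP (@ring_in_K0 R) (@ring_in_KD R).
have invQ x : x \in ideal_mul_inverse I -> ring_in_K x.
  move=> Ix; apply/QP; apply: generated_min Ix => _ [a [y [Ia Iy ->]]].
  exact/QP/Iy.
have [J GVJ JP] : exists2 J, GV_ideal J & {subset J <= submod_of P0 PD}.
  apply: contrapT => noGV.
  have [|m maxm Am] := w_Max_above (A := submod_of P0 PD).
    by move=> J GVJ JA; apply: noGV; exists J.
  have [a [u [sa na um uP]]] := local_pivot maxm s0.
  have Ia : (a : R^o) \in I by rewrite sP mem_generated.
  have [x ax] := fracmod_div na (tofrac u : fracmod R).
  case/negP: um; apply: Am; apply/PP; rewrite /P /= -ax.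
  apply: mem_generated; exists a, x; split=> // b.
  pose T : set R^o := [set b : R^o | ring_in_K ((b : R) *: x)].
  have T0 : T 0 by rewrite /T /= scale0r; exact: ring_in_K0.
  have TD (k : R) y z : T y -> T z -> T (k *: y + z).
    by rewrite /T /= => Ty Tz; rewrite scalerDl -scalerA; exact: ring_in_KD.
  rewrite sP => Ib; apply/(submod_ofP T0 TD); apply: generated_min Ib => c cs.
  apply/(submod_ofP T0 TD); have [d cd] := uP c cs.
  exists d => //; apply: (fracmod_scalerI na).
  by rewrite scalerA [a * _]mulrC -scalerA ax !fracmod_scaleE -!tofracM -cd mulrC.
apply/seteqP; split=> [x [J' GVJ' J'x]|_ [r _ <-]]; last first.
  exists J => // j /JP/PP; rewrite /P /= => Pj.
  by rewrite fracmod_scaleE mulrC; exact: (rpredZ r).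
(* Conversely, a fraction that a GV-ideal multiplies into [I I^-1], hence into R, lies in R by
   [GV_closed]. *)
have [a [b [b0 bx]]] := fracmod_numden x.
have [_ _ cJ'] := (GV_idealP J').1 GVJ'.
have [|c ac] := cJ' a b b0.
  move=> j /J'x/invQ[c _ cE]; exists c; apply: tofrac_inj.
  by rewrite !tofracM cE -bx !fracmod_scaleE; ring.
by exists c => //; apply: (fracmod_scalerI b0); rewrite bx ac tofracM.
Qed.

End PvMDConverse.

Theorem theorem5p5 (R : idomainType) :
  PvMD R <->
  forall E : lmodType R,
    pure_w_injective E -> divisible_module E -> injective_module E.
Proof.
split=> [pvmd E pwiE divE|divinj].
  exact: PvMD_divisible_injective.
exact: divisible_injective_PvMD.
Qed.
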